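(* Let $\Omega$ be a countably infinite set and let $G\leq\mathrm{Sym}(\Omega)$ be a closed subgroup with no algebraicity. Then every dissociated unitary representation $\pi\colon G\to\mathcal{U}(\mathcal{H})$ is isomorphic to a direct sum $\bigoplus_{i\in I}\pi_i$ of irreducible representations, where for every $i\in I$ there exists a finite subset $A_i\subseteq\Omega$ such that $\pi_i$ is induced from an irreducible representation $\sigma_i$ of the setwise stabilizer $G_{\{A_i\}}$ which factors through the finite group $G_{\{A_i\}}/G_{A_i}$.
   Context: $\mathrm{Sym}(\Omega)$ is the group of all permutations of $\Omega$, with the topology of pointwise convergence ($\Omega$ discrete). For $A\subseteq\Omega$ finite, $G_A=\{g\in G: g(a)=a\ \forall a\in A\}$ (pointwise stabilizer) and $G_{\{A\}}=\{g\in G: g(A)=A\}$ (setwise stabilizer). $G$ has no algebraicity if for every finite $A\subseteq\Omega$, the action $G_A\curvearrowright\Omega\setminus A$ has no finite orbit. Unitary representations are homomorphisms into the unitary group of a complex Hilbert space (which may be assumed separable), continuous for the strong operator topology. For a unitary representation $\pi\colon G\to\mathcal{U}(\mathcal{H})$ and $A\subseteq\Omega$ finite, $\mathcal{H}_A$ denotes the subspace of $G_A$-invariant vectors. For closed subspaces with $\mathcal{H}_2\subseteq\mathcal{H}_1\cap\mathcal{H}_3$, $\mathcal{H}_1$ and $\mathcal{H}_3$ are orthogonal conditionally on $\mathcal{H}_2$ if $\mathcal{H}_1\cap\mathcal{H}_2^\perp$ and $\mathcal{H}_3\cap\mathcal{H}_2^\perp$ are orthogonal. $\pi$ is dissociated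 if for all finite $A,B\subseteq\Omega$, $\mathcal{H}_A$ and $\mathcal{H}_B$ are orthogonal conditionally on $\mathcal{H}_{A\cap B}$. If $H\le G$ is an open subgroup and $\sigma\colon H\to\mathcal{U}(\mathcal{K})$ is a unitary representation, the induced representation $\mathrm{Ind}_H^G(\sigma)$ is the representation of $G$ by $(\pi(g)f)(x)=f(g^{-1}x)$ on the Hilbert space of maps $f\colon G\to\mathcal{K}$ such that $f(gh)=\sigma(h^{-1})f(g)$ for all $g\in G,h\in H$ and $\sum_{q\in G/H}\|f(q)\|^2<\infty$, where $\|f(q)\|$ is the constant value of $\|f(\cdot)\|$ on the coset $q$. *)

(* Defs.v *)
From HB Require Import structures.
From mathcomp Require Import all_boot all_order all_algebra.
From mathcomp Require Import all_classical all_reals all_analysis.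
From mathcomp Require Import complex.

Set Implicit Arguments.
Unset Strict Implicit.
Unset Printing Implicit Defensive.

Import Order.TTheory GRing.Theory Num.Theory.
Import numFieldNormedType.Exports.

Local Open Scope classical_set_scope.
Local Open Scope ring_scope.

HB.mixin Record isTopologicalGroup G of Group G & Topological G := {
  mulg_continuous : continuous (fun x : G * G => (x.1 * x.2)%g) ;
  invg_continuous : continuous (fun x : G => (x^-1)%g) }.

#[short(type="topologicalGroupType")]
HB.structure Definition TopologicalGroup :=
  {G of Group G & Topological G & isTopologicalGroup G}.

Record subgroup (G : groupType) := Subgroup {
  subgroup_set :> set G ;
  subgroup1 : subgroup_set 1%g ;
  subgroupV : forall g, subgroup_set g -> subgroup_set (g^-1)%g ;
  subgroupM : forall g h,
    subgroup_set g -> subgroup_set h -> subgroup_set (g * h)%g }.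

(* A subgroup H coerces to the set of its elements and, through set_type, to  *)
(* the type of its elements: a group, with the subspace topology.             *)
Lemma subgroup_closed (G : groupType) (H : subgroup G) :
  group_closed (fun g : G => g \in subgroup_set H).
Proof.
split=> [|g h]; first by apply/mem_set; exact: subgroup1.
move=> /set_mem gH /set_mem hH; apply/mem_set.
by apply: subgroupM => //; exact: subgroupV.
Qed.

HB.instance Definition _ (G : groupType) (H : subgroup G) :=
  SubChoice.copy (set_type H) {g : G | g \in subgroup_set H}.
HB.instance Definition _ (G : groupType) (H : subgroup G) :=
  SubChoice_isSubGroup.Build G (fun g : G => g \in subgroup_set H) (set_type H)
    (subgroup_closed H).

Section subgroup_topology.
Variables (G : topologicalGroupType) (H : subgroup G).

Let mulg_cont : continuous (fun x : H * H => (x.1 * x.2)%g).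
Proof.
apply: (@continuous_comp_initial _ _ _ (set_val : H -> G)) => x.
rewrite (_ : set_val \o _ =
  (fun y : G * G => (y.1 * y.2)%g) \o (fun y : H * H => (val y.1, val y.2)));
  last by [].
apply: continuous_comp; last exact: mulg_continuous.
apply: (@cvg_pair _ _ _ _ (nbhs (val x.1)) (nbhs (val x.2))).
  by apply: (@cvg_comp _ _ _ fst (val : H -> G) _ (nbhs x.1));
     [exact: cvg_fst|exact: (@initial_continuous _ _ (set_val : H -> G))].
by apply: (@cvg_comp _ _ _ snd (val : H -> G) _ (nbhs x.2));
   [exact: cvg_snd|exact: (@initial_continuous _ _ (set_val : H -> G))].
Qed.

Let invg_cont : continuous (fun x : H => (x^-1)%g).
Proof.
apply: (@continuous_comp_initial _ _ _ (set_val : H -> G)) => x.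
rewrite (_ : set_val \o _ = (fun y : G => (y^-1)%g) \o (set_val : H -> G));
  last by [].
apply: continuous_comp; last exact: invg_continuous.
exact: (@initial_continuous _ _ (set_val : H -> G)).
Qed.

HB.instance Definition _ :=
  isTopologicalGroup.Build (set_type H) mulg_cont invg_cont.

End subgroup_topology.

Definition bijections (T : choiceType) :
    set {ptws T -> discrete_topology T} :=
  [set f | bijective (f : T -> T)].

Definition sym (T : choiceType) := set_type (@bijections T).

Section sym.
Variable T : choiceType.

HB.instance Definition _ := Topological.copy (sym T) (set_type (@bijections T)).

Definition sym_fun (s : sym T) : T -> T := val s.
Coercion sym_fun : sym >-> Funclass.

Lemma sym_bij (s : sym T) : bijective s.
Proof. by case: s => f fP; exact: (set_mem fP). Qed.

Lemma sym_eq (s t : sym T) : s =1 t -> s = t.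
Proof. by move=> st; apply/val_inj/funext => a; exact: st. Qed.

Definition mk_sym (f : T -> T) (fP : bijective f) : sym T :=
  exist _ (f : {ptws T -> discrete_topology T}) (mem_set fP).

Let one_sym : sym T := mk_sym (Bijective (frefl id) (frefl id)).

Let mul_sym (s t : sym T) : sym T := mk_sym (bij_comp (sym_bij s) (sym_bij t)).

Let sym_inv (s : sym T) :
  {g : T -> T | bijective g & cancel s g /\ cancel g s}.
Proof.
by apply: cid2; have [g sK gK] := sym_bij s; exists g => //; exists s.
Qed.

Let inv_sym (s : sym T) : sym T := mk_sym (s2valP (sym_inv s)).

Let mulVs : left_inverse one_sym inv_sym mul_sym.
Proof. by move=> s; apply: sym_eq => a; case: (s2valP' (sym_inv s)) => sK _; exact: sK. Qed.

Let mulsV : right_inverse one_sym inv_sym mul_sym.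
Proof. by move=> s; apply: sym_eq => a; case: (s2valP' (sym_inv s)) => _ sK; exact: sK. Qed.

Let mulsA : associative mul_sym.
Proof. by move=> s t u; exact: sym_eq. Qed.

Let mul1s : left_id one_sym mul_sym.
Proof. by move=> s; exact: sym_eq. Qed.

Let muls1 : right_id one_sym mul_sym.
Proof. by move=> s; exact: sym_eq. Qed.

HB.instance Definition _ :=
  isGroup.Build (sym T) mulsA mul1s muls1 mulVs mulsV.

Lemma sym1E a : (1%g : sym T) a = a. Proof. by []. Qed.

Lemma symME (s t : sym T) a : sym_fun (s * t)%g a = s (t a). Proof. by []. Qed.

Lemma symK (s : sym T) : cancel s (sym_fun (s^-1)%g).
Proof. by move=> a; rewrite -symME mulVg. Qed.

Lemma symVK (s : sym T) : cancel (sym_fun (s^-1)%g) s.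
Proof. by move=> a; rewrite -symME mulgV. Qed.

Lemma continuous_sym_eval a :
  continuous (fun t : sym T => t a : discrete_topology T).
Proof.
move=> s U /(@proj_continuous T (fun=> discrete_topology T) a (val s)).
by move/(@initial_continuous _ {ptws T -> discrete_topology T} val s).
Qed.

Lemma cvg_symP (F : set_system (sym T)) (s : sym T) : Filter F ->
  F --> s <-> forall a, F [set t : sym T | t a = s a].
Proof.
move=> FF; split=> [Fs a|Fs].
  have := @continuous_sym_eval a s _ (@discrete_set1 (discrete_topology T) _).
  by move/Fs.
suff valF : val @ F --> (val s : {ptws T -> discrete_topology T}).
  move=> U [V [[W oW <-] Ws] /filterS]; apply.
  by apply: valF; exact: open_nbhs_nbhs.
apply/cvg_sup => a U [V [[W oW <-] Ws] /filterS]; apply.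
suff : F [set t : sym T | W (t a)] by [].
apply: filterS (Fs a) => t ta.
by rewrite /= (ta : t a = s a).
Qed.

Let cvg_sym (s : sym T) a : nbhs s [set t : sym T | t a = s a].
Proof. by move: a; apply/cvg_symP. Qed.

Let mulg_cont : continuous (fun x : sym T * sym T => (x.1 * x.2)%g).
Proof.
move=> x; apply/cvg_symP => a.
exists ([set s : sym T | s (sym_fun x.2 a) = sym_fun x.1 (sym_fun x.2 a)],
  [set t : sym T | t a = sym_fun x.2 a]); first by split; exact: cvg_sym.
case=> s t [/= sE tE].
by rewrite [LHS]symME (tE : sym_fun t a = _) symME.
Qed.

Let invg_cont : continuous (fun x : sym T => (x^-1)%g).
Proof.
move=> s; have FF : Filter (fmap (fun x : sym T => (x^-1)%g) (nbhs s)).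
  exact: (@fmap_filter _ _ (fun x : sym T => (x^-1)%g) (nbhs s) (nbhs_filter s)).
apply/cvg_symP => a; set b := sym_fun (s^-1)%g a.
have : nbhs s [set t : sym T | t b = sym_fun s b] by exact: cvg_sym.
apply: filterS => t /= tb.
by rewrite -[RHS](symK t) (tb : sym_fun t b = _) symVK.
Qed.

HB.instance Definition _ :=
  isTopologicalGroup.Build (sym T) mulg_cont invg_cont.

End sym.

Section permutation_group.
Variables (Omega : choiceType) (G : subgroup (sym Omega)).

Definition gact (g : G) : Omega -> Omega := sym_fun (val g).

Lemma gact1 a : gact 1%g a = a. Proof. by []. Qed.

Lemma gactM g h a : gact (g * h)%g a = gact g (gact h a). Proof. by []. Qed.

Lemma gactK g : cancel (gact g) (gact (g^-1)%g).
Proof. by move=> a; rewrite -gactM mulVg. Qed.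

Program Definition pointwise_stab (A : set Omega) : subgroup G :=
  @Subgroup G [set g | forall a, A a -> gact g a = a] _ _ _.
Next Obligation. by []. Qed.
Next Obligation. by move=> A g gA a Aa; rewrite -[in LHS](gA a Aa) gactK. Qed.
Next Obligation. by move=> A g h gA hA a Aa; rewrite gactM hA// gA. Qed.

Program Definition setwise_stab (A : set Omega) : subgroup G :=
  @Subgroup G [set g | gact g @` A = A] _ _ _.
Next Obligation. by move=> A; rewrite /= image_id. Qed.
Next Obligation.
move=> A g /= gA; rewrite -[in LHS]gA image_comp.
by rewrite (_ : _ \o _ = id) ?image_id//; apply/funext => a /=; rewrite gactK.
Qed.
Next Obligation. by move=> A g h /= gA hA; rewrite -[RHS]gA -[in RHS]hA image_comp. Qed.

Definition no_algebraicity := forall A : set Omega, finite_set A ->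
  forall a, ~ A a -> infinite_set [set gact g a | g in pointwise_stab A].

End permutation_group.

(* hdot is linear in its first argument. The norm of a normed module over     *)
(* R[i] takes its values in R[i].                                             *)
HB.mixin Record isHilbert (R : realType) V of CompleteNormedModule R[i] V := {
  hdot : {dot V for (@Num.conj R[i])} ;
  hdot_norm : forall v : V, hdot v v = `|v| ^+ 2 }.

#[short(type="hilbertType")]
HB.structure Definition Hilbert (R : realType) :=
  {V of CompleteNormedModule R[i] V & isHilbert R V}.

Section hilbert.
Variable R : realType.
Implicit Types V W : hilbertType R.

Definition sqnorm V (v : V) : R := complex.Re (`|v| ^+ 2).

Definition orthogonal V (S T : set V) : Prop :=
  forall u v, S u -> T v -> hdot u v = 0.

Definition orthocomp V (S : set V) : set V :=
  [set v | forall u, S u -> hdot v u = 0].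

Definition cond_orthogonal V (H1 H3 H2 : set V) : Prop :=
  orthogonal (H1 `&` orthocomp H2) (H3 `&` orthocomp H2).

Definition closed_subspace V (S : set V) : Prop :=
  [/\ closed S, S 0 & forall (a : R[i]) u v, S u -> S v -> S (a *: u + v)].

Definition unitary V W (U : {linear V -> W}) : Prop :=
  bijective U /\ forall u v, hdot (U u) (U v) = hdot u v.

(* The continuity of every orbit map g |-> pi(g)v is the continuity of pi for *)
(* the strong operator topology.                                              *)
Record unitary_rep (G : topologicalGroupType) V := UnitaryRep {
  rep :> G -> {linear V -> V} ;
  rep_unitary : forall g, unitary (rep g) ;
  repM : forall g h v, rep (g * h)%g v = rep g (rep h v) ;
  rep_continuous : forall v, continuous (fun g => rep g v) }.

Section unitary_rep.
Variables (G : topologicalGroupType) (V : hilbertType R).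
Variable pi : unitary_rep G V.

Definition invariants (S : set G) : set V :=
  [set v | forall g, S g -> pi g v = v].

Definition irreducible : Prop :=
  (exists v : V, v != 0) /\
  forall S : set V, closed_subspace S ->
    (forall g v, S v -> S (pi g v)) -> S = [set 0] \/ S = setT.

(* pi is constant on the left cosets of N, that is, pi is the composition of  *)
(* the projection onto G / N and of a map defined on G / N.                   *)
Definition factors_through (N : set G) : Prop :=
  forall g h, N (g^-1 * h)%g -> forall v, pi g v = pi h v.

Definition l2_sum (I : choiceType) (W : I -> hilbertType R) :
    set (forall i, W i) :=
  [set w | (\esum_(i in [set: I]) (sqnorm (w i))%:E < +oo)%E].

(* pi is isomorphic to the Hilbert direct sum of the pi_ i: the v |-> T i v   *)
(* are the components of an equivariant, linear, norm-preserving bijection    *)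
(* from V to the square-summable families.                                    *)
Definition iso_direct_sum (I : choiceType) (W : I -> hilbertType R)
    (pi_ : forall i, unitary_rep G (W i)) : Prop :=
  exists T : forall i, {linear V -> W i},
  [/\ range (fun v i => T i v) = l2_sum (W := W),
      forall v, \esum_(i in [set: I]) (sqnorm (T i v))%:E = (sqnorm v)%:E
    & forall i g v, T i (pi g v) = pi_ i g (T i v)].

End unitary_rep.

Section induced.
Variables (G : topologicalGroupType) (H : subgroup G) (K : hilbertType R).
Variable sigma : unitary_rep H K.

Definition left_cosets : set (set G) :=
  range (fun g : G => [set (g * h)%g | h in (H : set G)]).

Definition equivariant (f : G -> K) : Prop :=
  forall (g : G) (h : H), f (g * val h)%g = sigma (h^-1)%g (f g).

(* The square norm of f on the coset q, read at a representative of q; for    *)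
(* equivariant f the choice is irrelevant, see coset_sqnormE.                 *)
Definition coset_sqnorm (f : G -> K) (q : set G) : R := sqnorm (f (xget 1%g q)).

Lemma sqnorm_unitary (V W : hilbertType R) (U : {linear V -> W}) (v : V) :
  unitary U -> sqnorm (U v) = sqnorm v.
Proof. by move=> [_ UE]; rewrite /sqnorm -!hdot_norm UE. Qed.

Lemma coset_sqnormE (f : G -> K) q g : equivariant f ->
  left_cosets q -> q g -> coset_sqnorm f q = sqnorm (f g).
Proof.
move=> fE [g0 _ <-]; rewrite /coset_sqnorm.
have fq x : [set (g0 * h)%g | h in (H : set G)] x -> sqnorm (f x) = sqnorm (f g0).
  move=> [h Hh <-]; rewrite -(sqnorm_unitary (f g0)
    (rep_unitary sigma (exist _ h (mem_set Hh) : H)^-1%g)).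
  by rewrite -fE.
by move=> qg; rewrite fq ?(fq g)//; apply: xgetI qg.
Qed.

Definition ind_sqnorm (f : G -> K) : \bar R :=
  \esum_(q in left_cosets) (coset_sqnorm f q)%:E.

Definition ind_space : set (G -> K) :=
  [set f | equivariant f /\ (ind_sqnorm f < +oo)%E].

Definition ind_act (g : G) (f : G -> K) : G -> K := fun x => f (g^-1 * x)%g.

(* pi is isomorphic to Ind_H^G(sigma): T is an equivariant, linear,           *)
(* norm-preserving bijection onto the space of the induced representation.    *)
Definition iso_induced (V : hilbertType R) (pi : unitary_rep G V) : Prop :=
  exists T : {linear V -> (G -> K)},
  [/\ range T = ind_space,
      forall v, ind_sqnorm (T v) = (sqnorm v)%:E
    & forall g v, T (pi g v) = ind_act g (T v)].

End induced.

Definition dissociated (Omega : choiceType) (G : subgroup (sym Omega)) V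
    (pi : unitary_rep G V) : Prop :=
  forall A B : set Omega, finite_set A -> finite_set B ->
  cond_orthogonal (invariants pi (pointwise_stab G A))
                  (invariants pi (pointwise_stab G B))
                  (invariants pi (pointwise_stab G (A `&` B))).

End hilbert.

(* Main.v *)
Require Import Defs.
From HB Require Import structures.
From mathcomp Require Import all_boot all_order all_algebra.
From mathcomp Require Import all_classical all_reals all_analysis.
From mathcomp Require Import complex finmap ring lra.

(** The heart of the proof is that every nonzero closed invariant subspace [S] of
    a dissociated representation contains an irreducible subrepresentation of the
    required induced form. A maximal orthogonal family of such subrepresentations,
    given by Zorn's lemma, then has zero orthogonal complement, and Parseval's
    identity turns the whole space into the direct sum of its members.

    By continuity a vector of [S] is moved little by the pointwise stabilizer of
    some finite set, and the least norm point of a convex set attached to its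
    orbit is then a nonzero vector of [S] fixed by that stabilizer
    ([exists_stab_invariant]). Choose a finite set [A] of least cardinality whose
    stabilizer fixes a nonzero vector of [S], and let [S_A] be the space of these
    fixed vectors. If [g A] differs from [A], the intersection of [A] and [g A] is
    smaller than [A], so its stabilizer fixes no nonzero vector of [S]; as the
    projection onto [S] commutes with the group, all vectors fixed by this smaller
    stabilizer are then orthogonal to [S], and dissociation makes [S_A] orthogonal
    to its translate by [g] ([minimal_support_ortho]).

    The setwise stabilizer of [A] acts on [S_A] through a finite group of
    permutations of [A], hence orbits in [S_A] are finite and [S_A] contains an
    irreducible subspace [K] ([exists_irreducible]). The translates of [K] are
    indexed by the cosets of the setwise stabilizer and are pairwise orthogonal,
    which means that their closed span [W] is the representation induced from [K]
    ([iso_induced_stabilizer]). The same orthogonality shows that the vectors of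
    [W] fixed by the pointwise stabilizer of [A] are those of [K]. As projections
    onto invariant subspaces preserve fixed vectors, a closed invariant subspace
    of [W] meets [K], and then is [W] by irreducibility of [K], or is zero
    ([irreducible_of_invariants]).

    Direct sums and induced representations are both handled through orthogonal
    families of closed subspaces ([orthogonal_synthesis], [parseval]), indexed
    respectively by the maximal family and by cosets. *)

Set Implicit Arguments.
Unset Strict Implicit.
Unset Printing Implicit Defensive.

Import Order.TTheory GRing.Theory Num.Theory.
Import numFieldNormedType.Exports.

Local Open Scope classical_set_scope.
Local Open Scope ring_scope.
Local Open Scope complex_scope.

(** * Real inner product and topology of a Hilbert space *)

Section inner_product.
Variables (R : realType) (V : hilbertType R).
Implicit Types (u v w : V) (a : R[i]) (t : R).

(** The underlying real inner product carries the Euclidean geometry and keeps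
    all estimates in [R], although norms are valued in [R[i]]. *)
Definition rdot u v : R := complex.Re (hdot u v).

Lemma ReD (a b : R[i]) : complex.Re (a + b) = complex.Re a + complex.Re b.
Proof. by case: a b => [? ?] [? ?]. Qed.

Lemma hdotC u v : hdot u v = (hdot v u)^*%R.
Proof. by rewrite hermC expr0 mul1r. Qed.

Lemma hdotDl u v w : hdot (u + v) w = hdot u w + hdot v w.
Proof. exact: linearDl. Qed.

Lemma hdotDr u v w : hdot u (v + w) = hdot u v + hdot u w.
Proof. exact: linearDr. Qed.

Lemma hdotBl u v w : hdot (u - v) w = hdot u w - hdot v w.
Proof. exact: linearBl. Qed.

Lemma hdotBr u v w : hdot u (v - w) = hdot u v - hdot u w.
Proof. exact: linearBr. Qed.

Lemma hdotZl a u v : hdot (a *: u) v = a * hdot u v.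
Proof. exact: linearZl_LR. Qed.

Lemma hdotZr a u v : hdot u (a *: v) = a^*%R * hdot u v.
Proof. exact: linearZr_LR. Qed.

Lemma hdotE v : hdot v v = (sqnorm v)%:C.
Proof.
rewrite /sqnorm -hdot_norm.
have := @dnorm_ge0 _ _ (@hdot R V) v; rewrite lecE => /andP[/eqP/=].
by case: (hdot v v) => a b /= -> _.
Qed.

Lemma rdotvv v : rdot v v = sqnorm v.
Proof. by rewrite /rdot hdotE. Qed.

Lemma sqnorm_ge0 v : 0 <= sqnorm v.
Proof. by rewrite -(@lecR R) -hdotE dnorm_ge0. Qed.

Lemma sqnorm_eq0 v : (sqnorm v == 0) = (v == 0).
Proof.
by rewrite -(@dnorm_eq0 _ _ (@hdot R V)) hdotE -(inj_eq (@complexI R)).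
Qed.

Lemma hdotvv_eq0 v : hdot v v = 0 -> v = 0.
Proof. by move=> /eqP; rewrite dnorm_eq0 => /eqP. Qed.

Lemma sqnorm0 : sqnorm (0 : V) = 0.
Proof. by apply/eqP; rewrite sqnorm_eq0. Qed.

Lemma norm_sqnorm v : `|v| = (Num.sqrt (sqnorm v))%:C.
Proof.
apply/eqP; rewrite -(@eqrXn2 _ 2)//; last by rewrite lecR sqrtr_ge0.
by rewrite -hdot_norm hdotE -rmorphXn/= sqr_sqrtr// sqnorm_ge0.
Qed.

Lemma rdotC u v : rdot u v = rdot v u.
Proof. by rewrite /rdot hdotC; case: (hdot v u). Qed.

Lemma rdotDl u v w : rdot (u + v) w = rdot u w + rdot v w.
Proof. by rewrite /rdot hdotDl ReD. Qed.

Lemma rdotDr u v w : rdot u (v + w) = rdot u v + rdot u w.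
Proof. by rewrite rdotC rdotDl !(rdotC u). Qed.

Lemma rdotZl t u v : rdot (t%:C *: u) v = t * rdot u v.
Proof.
by rewrite /rdot hdotZl; case: (hdot u v) => a b /=; rewrite mul0r subr0.
Qed.

Lemma rdotZr t u v : rdot u (t%:C *: v) = t * rdot u v.
Proof. by rewrite rdotC rdotZl rdotC. Qed.

Lemma rdotNl u v : rdot (- u) v = - rdot u v.
Proof. by rewrite -scaleN1r -(rmorphN1 (real_complex R)) rdotZl mulN1r. Qed.

Lemma rdotBl u v w : rdot (u - v) w = rdot u w - rdot v w.
Proof. by rewrite rdotDl rdotNl. Qed.

Lemma rdotBr u v w : rdot u (v - w) = rdot u v - rdot u w.
Proof. by rewrite rdotC rdotBl !(rdotC u). Qed.

(** Testing against all complex multiples recovers the vanishing of both real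
    and imaginary parts from that of real parts only. *)
Lemma hdot_eq0P u v : hdot u v = 0 <-> forall a, rdot u (a *: v) = 0.
Proof.
split=> [uv a|uv]; first by rewrite /rdot hdotZr uv mulr0.
have /= := uv (hdot u v); rewrite /rdot hdotZr.
case: (hdot u v) => a b /= h.
have [-> ->] : a = 0 /\ b = 0 by split; nra.
by [].
Qed.

Lemma hdot0_sym u v : hdot u v = 0 -> hdot v u = 0.
Proof. by rewrite hdotC => /(congr1 Num.conj); rewrite conjCK conjC0. Qed.

Lemma sqnormD u v : sqnorm (u + v) = sqnorm u + sqnorm v + 2 * rdot u v.
Proof. by rewrite -!rdotvv rdotDl !rdotDr (rdotC v u); ring. Qed.

Lemma sqnormB u v : sqnorm (u - v) = sqnorm u + sqnorm v - 2 * rdot u v.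
Proof. by rewrite -!rdotvv rdotBl !rdotBr (rdotC v u); ring. Qed.

Lemma sqnormZ t u : sqnorm (t%:C *: u) = t ^+ 2 * sqnorm u.
Proof. by rewrite -!rdotvv rdotZl rdotZr; ring. Qed.

Lemma sqnormN u : sqnorm (- u) = sqnorm u.
Proof. by rewrite -!rdotvv rdotNl rdotC rdotNl opprK. Qed.

Lemma sqnorm_distC u v : sqnorm (u - v) = sqnorm (v - u).
Proof. by rewrite -opprB sqnormN. Qed.

Lemma pythagoras u v : hdot u v = 0 -> sqnorm (u + v) = sqnorm u + sqnorm v.
Proof. by move=> uv; rewrite sqnormD /rdot uv/= mulr0 addr0. Qed.

(** Real Cauchy-Schwarz in a form without square roots: the discriminant of
    [t |-> sqnorm (u - t v)]. *)
Lemma rdot_cauchy_schwarz u v : rdot u v ^+ 2 <= sqnorm u * sqnorm v.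
Proof.
have [v0|v_neq0] := eqVneq (sqnorm v) 0.
  move/eqP: (v0); rewrite sqnorm_eq0 => /eqP ->.
  by rewrite /rdot linear0r/= sqnorm0 expr0n/= mulr0.
have v_gt0 : 0 < sqnorm v by rewrite lt_def v_neq0 sqnorm_ge0.
have := sqnorm_ge0 ((sqnorm v)%:C *: u - (rdot u v)%:C *: v).
rewrite sqnormB !sqnormZ rdotZl rdotZr => h.
rewrite -subr_ge0 -(pmulr_rge0 _ v_gt0); apply: le_trans h _.
by rewrite le_eqVlt; apply/orP; left; apply/eqP; ring.
Qed.

Lemma sqnormD_le u v : sqnorm (u + v) <= 2 * (sqnorm u + sqnorm v).
Proof. by have := sqnorm_ge0 (u - v); rewrite sqnormB sqnormD; lra. Qed.

Lemma ball_sqnorm v (e : R) w : 0 < e ->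
  ball v e%:C w <-> sqnorm (w - v) < e ^+ 2.
Proof.
move=> e0; rewrite -ball_normE /ball_/= norm_sqnorm ltcR sqnorm_distC.
by rewrite -[X in _ < X]ger0_norm ?ltW// -sqrtr_sqr ltr_sqrt ?exprn_gt0.
Qed.

(** Radii are real square norms rather than elements of [R[i]], so that estimates
    can stay in [R]. *)
Lemma nbhs_sqnorm v (U : set V) :
  nbhs v U <-> exists2 e : R, 0 < e & forall w, sqnorm (w - v) < e -> U w.
Proof.
rewrite -nbhs_ballE; split=> [[e /= e0 eU]|[e e0 eU]].
  have eE : e = (complex.Re e)%:C.
    by move: e0; rewrite ltcE => /andP[/eqP/=]; case: (e) => ? ? /= ->.
  have e0' : 0 < complex.Re e by rewrite -(@ltcR R) -eE.
  exists (complex.Re e ^+ 2); first by rewrite exprn_gt0.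
  by move=> w we; apply: eU; rewrite eE; apply/ball_sqnorm.
exists (Num.sqrt e)%:C; first by rewrite /= ltcR sqrtr_gt0.
move=> w /ball_sqnorm; rewrite sqr_sqrtr ?ltW//.
by rewrite sqrtr_gt0 => /(_ e0); exact: eU.
Qed.

Lemma closed_sqnormP (S : set V) : closed S <-> forall v,
  (forall e : R, 0 < e -> exists2 y, S y & sqnorm (y - v) < e) -> S v.
Proof.
split=> [cS v vS|cS v vS].
  apply: cS => U /nbhs_sqnorm[e e0 eU].
  by have [y Sy ye] := vS e e0; exists y; split => //; exact: eU.
apply: cS => e e0.
have [|y [Sy ye]] := vS [set w | sqnorm (w - v) < e].
  by apply/nbhs_sqnorm; exists e.
by exists y.
Qed.

End inner_product.

(** * Minimising vectors *)

Section minimising_vectors.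
Variables (R : realType) (V : hilbertType R).
Implicit Types (u v w : V) (a : R[i]) (t e : R) (S : set V).

(** The common form of the two completeness arguments below: a family is Cauchy
    along any sequence minimising a potential that controls its mutual distances.
    For least norm points the potential is the square norm, for orthogonal sums
    it is minus the sum of the square norms. *)
Lemma potential_limit (X : Type) (f : X -> V) (phi : X -> R) (m : R) :
  (forall x, m <= phi x) -> (forall e, 0 < e -> exists x, phi x < m + e) ->
  (forall x y, sqnorm (f x - f y) <= 2 * ((phi x - m) + (phi y - m))) ->
  exists v, forall x, sqnorm (f x - v) <= 4 * (phi x - m).
Proof.
move=> m_le m_inf f_phi.
(* The sublevel sets of the potential, pushed forward along [f]. *)
pose F := filter_from [set e : R | 0 < e]
  (fun e => f @` [set x | phi x < m + e]).
have FF : ProperFilter F.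
  apply: filter_from_proper => [|e /m_inf[x xe]]; last first.
    by exists (f x); exists x.
  apply: filter_from_filter; first by exists 1; exact: ltr01.
  move=> e1 e2 e10 e20; exists (Num.min e1 e2); first by rewrite /= lt_min e10.
  move=> _ [x /= xe <-]; split; exists x => //=; apply: (lt_le_trans xe).
    by rewrite lerD2l ge_min lexx.
  by rewrite lerD2l ge_min lexx orbT.
have cF : cauchy F.
  apply: cauchy_exP => e e0.
  have [x0 _] := m_inf 1 ltr01.
  have /nbhs_sqnorm[d d0 dball] : nbhs (f x0) (ball (f x0) e).
    exact: nbhsx_ballx.
  have d40 : 0 < d / 4 by rewrite divr_gt0.
  have [x xd] := m_inf _ d40; exists (f x), (d / 4) => // _ [y /= yd <-].
  have : ball (f x0) e (f x0 + (f y - f x)).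
    apply: dball; rewrite addrAC subrr add0r.
    by apply: (le_lt_trans (f_phi _ _)); lra.
  rewrite -!ball_normE /ball_/=.
  by rewrite opprD addrA subrr add0r opprB.
have Fv : F --> lim F := cauchy_cvg F cF.
set v := lim F in Fv.
exists v => x; apply/ler_addgt0Pl => e e0.
have e160 : 0 < e / 16 by rewrite divr_gt0.
have : F [set w | sqnorm (w - v) < e / 16].
  by apply: Fv; apply/nbhs_sqnorm; exists (e / 16).
move=> [d d0 dF].
have md : 0 < Num.min d (e / 16) by rewrite lt_min d0.
have [y] := m_inf _ md; rewrite -ltrBlDl lt_min => /andP[yd ye].
have yv : sqnorm (f y - v) < e / 16.
  by apply: dF; exists y => //=; rewrite -ltrBlDl.
have := sqnormD_le (f x - f y) (f y - v); rewrite addrA subrK => h1.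
by have := f_phi x y; lra.
Qed.

(** Lower semicontinuity of the square norm: by Cauchy-Schwarz, it drops by at
    most a multiple of the square root of [e] from [v] to a point at square
    distance [e]. *)
Lemma sqnorm_limit_le v (c : R) :
  (forall e, 0 < e -> exists2 x, sqnorm (x - v) < e & sqnorm x <= c + e) ->
  sqnorm v <= c.
Proof.
move=> vx; rewrite leNgt; apply/negP => cv.
set N := sqnorm v in cv; pose d := N - c.
have d0 : 0 < d by rewrite subr_gt0.
have N0 : 0 <= N by exact: sqnorm_ge0.
have N1 : 0 < 16 * (N + 1) by lra.
(* For this [e] the drop [d - e] contradicts Cauchy-Schwarz. *)
pose e := Num.min (d / 2) (d ^+ 2 / (16 * (N + 1))).
have e0 : 0 < e by rewrite lt_min !divr_gt0// exprn_gt0.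
have ed : e <= d / 2 by rewrite ge_min lexx.
have eN : 16 * (N + 1) * e <= d ^+ 2.
  by rewrite mulrC -ler_pdivlMr// ge_min lexx orbT.
have [x xv xc] := vx e e0.
have := rdot_cauchy_schwarz v (v - x).
rewrite -/N sqnorm_distC => cs.
have h : rdot v (v - x) >= (d - e) / 2.
  have := sqnormB v (v - x); rewrite opprB addrC subrK sqnorm_distC -/N => h.
  by have := sqnorm_ge0 (x - v); rewrite /d; lra.
have h2 : ((d - e) / 2) ^+ 2 <= rdot v (v - x) ^+ 2.
  by rewrite lerXn2r// nnegrE; lra.
have h3 : (d / 4) ^+ 2 <= ((d - e) / 2) ^+ 2 by rewrite lerXn2r// ?nnegrE; lra.
have h4 : N * sqnorm (x - v) <= N * e by rewrite ler_wpM2l// ltW.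
by lra.
Qed.

(** The midpoint of two almost minimal points lies in [C], so the parallelogram
    law bounds their distance: minimising sequences are Cauchy. *)
Lemma min_norm_point (C : set V) : closed C -> C !=set0 ->
  (forall x y, C x -> C y -> C ((2^-1)%:C *: (x + y))) ->
  exists2 x, C x & forall y, C y -> sqnorm x <= sqnorm y ?= iff (y == x).
Proof.
move=> /closed_sqnormP cC [x0 Cx0] midC.
pose m := inf [set sqnorm y | y in C].
have lbC : has_lbound [set sqnorm y | y in C].
  by exists 0 => _ [y _ <-]; exact: sqnorm_ge0.
have m_le y : C y -> m <= sqnorm y by move=> Cy; apply: ge_inf => //; exists y.
have parallelogram x y : C x -> C y ->
    sqnorm (x - y) <= 2 * ((sqnorm x - m) + (sqnorm y - m)).
  move=> Cx Cy; have := m_le _ (midC _ _ Cx Cy).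
  by rewrite sqnormZ sqnormB sqnormD; lra.
have m_inf e : 0 < e -> exists x : {v | C v}, sqnorm (sval x) < m + e.
  move=> e0.
  have [|_ [y Cy <-] ye] := @inf_adherent _ [set sqnorm y | y in C] _ e0.
    by split => //; exists (sqnorm x0); exists x0.
  by exists (exist _ y Cy).
have [v vC] := potential_limit (fun x => m_le _ (svalP x)) m_inf
  (fun x y => parallelogram _ _ (svalP x) (svalP y)).
have Cv : C v.
  apply: cC => e e0; have e40 : 0 < e / 4 by rewrite divr_gt0.
  have [x xe] := m_inf _ e40; exists (sval x); first exact: svalP.
  by apply: (le_lt_trans (vC x)); lra.
have vm : sqnorm v <= m.
  apply: sqnorm_limit_le => e e0; have e40 : 0 < e / 4 by rewrite divr_gt0.
  have [x xe] := m_inf _ e40; exists (sval x); last by lra.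
  by apply: (le_lt_trans (vC x)); lra.
exists v => // y Cy; apply/leifP; case: eqVneq => [->//|yv].
rewrite lt_neqAle (le_trans vm (m_le _ Cy)) andbT; apply: contra_neq yv => ye.
have ym : sqnorm y <= m by rewrite -ye.
apply/eqP; rewrite -subr_eq0 -sqnorm_eq0 eq_le sqnorm_ge0 andbT.
by have := parallelogram _ _ Cy Cv; lra.
Qed.

End minimising_vectors.

(** * Closed subspaces and orthogonal decompositions *)

Section closed_subspaces.
Variables (R : realType) (V : hilbertType R).
Implicit Types (u v w : V) (a : R[i]) (t e : R) (S : set V).

Lemma closed_subspace0 S : closed_subspace S -> S 0. Proof. by case. Qed.

Lemma closed_subspaceZ S a u : closed_subspace S -> S u -> S (a *: u).
Proof. by case=> _ S0 SP Su; rewrite -[_ *: _]addr0; exact: SP. Qed.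

Lemma closed_subspaceD S u v : closed_subspace S -> S u -> S v -> S (u + v).
Proof. by case=> _ S0 SP Su Sv; rewrite -[u]scale1r; exact: SP. Qed.

Lemma closed_subspaceB S u v : closed_subspace S -> S u -> S v -> S (u - v).
Proof.
move=> cS Su Sv; apply: closed_subspaceD => //.
by rewrite -scaleN1r; exact: closed_subspaceZ.
Qed.

Lemma closed_subspaceI S T :
  closed_subspace S -> closed_subspace T -> closed_subspace (S `&` T).
Proof.
move=> [cS S0 SP] [cT T0 TP]; split; first exact: closedI.
  by [].
by move=> a u v [Su Tu] [Sv Tv]; split; [exact: SP|exact: TP].
Qed.

Lemma closed_subspace_orthocomp S : closed_subspace (orthocomp S).
Proof.
split; last 2 first.
- by move=> u _; rewrite linear0l.
- by move=> a u v uS vS w Sw; rewrite hdotDl hdotZl uS// vS// mulr0 addr0.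
apply/closed_sqnormP => v vS u Su; apply/hdot_eq0P => a.
apply/eqP; rewrite -sqrf_eq0 eq_le sqr_ge0 andbT.
apply/ler_addgt0Pl => e e0; rewrite addr0.
pose N := sqnorm (a *: u); have N0 : 0 <= N by exact: sqnorm_ge0.
have [|y Sy yv] := vS (e / (N + 1)); first by rewrite divr_gt0//; lra.
have -> : rdot v (a *: u) = rdot (v - y) (a *: u).
  by rewrite rdotBl (hdot_eq0P y u).1 ?subr0//; exact: Sy.
apply: (le_trans (rdot_cauchy_schwarz _ _)); rewrite -/N sqnorm_distC.
apply: (@le_trans _ _ (e / (N + 1) * N)); first by rewrite ler_wpM2r// ltW.
by rewrite mulrAC ler_pdivrMr; [rewrite ler_wpM2l ?(ltW e0)//|]; lra.
Qed.

(** The least norm point of the coset [v + S] is the component of [v] orthogonal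
    to [S]. *)
Lemma orthogonal_decomposition S v : closed_subspace S ->
  exists2 p, S p & orthocomp S (v - p).
Proof.
move=> cS; pose C := [set x | S (v - x)].
have cC : closed C.
  apply/closed_sqnormP => x xC; case: (cS) => /closed_sqnormP + _ _; apply.
  move=> e /xC[y Cy ye]; exists (v - y) => //.
  by rewrite opprB addrC addrA subrK sqnorm_distC.
have midC x y : C x -> C y -> C ((2^-1)%:C *: (x + y)).
  rewrite /C/= => Cx Cy.
  have -> : v - (2^-1)%:C *: (x + y) = (2^-1)%:C *: ((v - x) + (v - y)).
    rewrite addrACA -opprD scalerBr -[v + v]mulr2n -(scaler_nat 2 v) scalerA.
    congr (_ - _); rewrite -[LHS]scale1r; congr (_ *: _).
    rewrite -(rmorph_nat (real_complex R)) -rmorphM/=.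
    by rewrite mulVf ?rmorph1 ?pnatr_eq0.
  by apply: closed_subspaceZ => //; exact: closed_subspaceD.
have [|x Cx x_min] := min_norm_point cC _ midC.
  by exists v; rewrite /C/= subrr; exact: closed_subspace0.
exists (v - x) => //; rewrite opprB addrC subrK => u Su.
apply/hdot_eq0P => a; set w := a *: u.
have h t : 0 <= t * (2 * rdot x w + t * sqnorm w).
  have : C (x + t%:C *: w).
    rewrite /C/= opprD addrA; apply: closed_subspaceB => //.
    by do 2!apply: closed_subspaceZ => //.
  by move=> /x_min[+ _]; rewrite sqnormD sqnormZ rdotZr; lra.
have N0 := sqnorm_ge0 w; set N := sqnorm w in h N0; set r := rdot x w in h *.
have N1 : N + 1 != 0 by lra.
(* The minimum over [t] is at [- r / N]; adding 1 to the denominator covers the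
   case [N = 0] and still gives a negative value unless [r = 0]. *)
have := h (- r / (N + 1)).
have -> : - r / (N + 1) * (2 * r + - r / (N + 1) * N) =
  - (r / (N + 1)) ^+ 2 * (N + 2) by field.
rewrite mulNr oppr_ge0 pmulr_lle0; last by lra.
move=> h0; have : (r / (N + 1)) ^+ 2 == 0 by rewrite eq_le h0 sqr_ge0.
by rewrite sqrf_eq0 mulf_eq0 invr_eq0 (negbTE N1) orbF => /eqP.
Qed.

End closed_subspaces.

(** * Closed subspaces as Hilbert spaces *)

Record csub (R : realType) (V : hilbertType R) := CSub {
  csub_set :> set V ;
  csubP : closed_subspace csub_set }.

(** An alias distinct from the type coercion of sets, because the latter already
    carries a topology, the subspace one, while here the topology has to be
    derived from the norm. *)
Definition hsub (R : realType) (V : hilbertType R) (S : csub V) :=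
  {v : V | v \in csub_set S}.

Section hsub.
Variables (R : realType) (V : hilbertType R) (S : csub V).

HB.instance Definition _ := SubChoice.copy (hsub S) {v : V | v \in csub_set S}.

Lemma hsub_closed : subsemimod_closed (fun v : V => v \in csub_set S).
Proof.
have cS := csubP S; split; first split.
- by apply/mem_set; exact: closed_subspace0.
- by move=> u v /set_mem Su /set_mem Sv; apply/mem_set; exact: closed_subspaceD.
- by move=> a v /set_mem Sv; apply/mem_set; exact: closed_subspaceZ.
Qed.

HB.instance Definition _ := GRing.SubChoice_isSubLmodule.Build R[i] V
  (fun v : V => v \in csub_set S) (hsub S) hsub_closed.

Let hsub_norm (v : hsub S) : R[i] := `|val v|.

Let hsub_normD u v : hsub_norm (u + v) <= hsub_norm u + hsub_norm v.
Proof. exact: ler_normD. Qed.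

Let hsub_normZ (a : R[i]) v : hsub_norm (a *: v) = `|a| * hsub_norm v.
Proof. exact: normrZ. Qed.

Let hsub_norm_eq0 v : hsub_norm v = 0 -> v = 0.
Proof. by move/eqP; rewrite normr_eq0 => /eqP v0; exact: val_inj. Qed.

HB.instance Definition _ := Lmodule_isNormed.Build R[i] (hsub S)
  hsub_normD hsub_normZ hsub_norm_eq0.

Let hsub_complete (F : set_system (hsub S)) :
  ProperFilter F -> cauchy F -> cvg F.
Proof.
move=> FF /cauchyP cF.
have vF : cauchy ((val : hsub S -> V) @ F).
  apply: cauchy_exP => e /cF[x Fx]; exists (val x).
  suff : F [set y | ball (val x) e (val y)] by [].
  by apply: filterS Fx => y; rewrite /= -!ball_normE.
have Fv : (val : hsub S -> V) @ F --> lim ((val : hsub S -> V) @ F).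
  exact: cauchy_cvg.
set v := lim _ in Fv.
have Sv : v \in csub_set S.
  apply/mem_set; have [cS _ _] := csubP S; apply: cS => U /Fv FU.
  have [y Uy] : [set y : hsub S | U (val y)] !=set0 by exact: (@filter_ex _ F).
  by exists (val y); split=> //; exact/set_mem/valP.
apply/cvg_ex; exists (Sub v Sv) => U.
rewrite -nbhs_ballE => -[e /= e0 eU].
have : F [set y : hsub S | ball v e (val y)].
  by apply: (Fv (ball v e)); exact: nbhsx_ballx.
apply: filterS => y; rewrite -ball_normE => ye.
by apply: eU; rewrite -ball_normE /ball_/= -[ `|_| ]/( `|val _| ) raddfB.
Qed.

HB.instance Definition _ := Uniform_isComplete.Build (hsub S) hsub_complete.

Definition hsub_dot (u v : hsub S) : R[i] := hdot (val u) (val v).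

Lemma val_hsubP (a : R[i]) (u v : hsub S) :
  val (a *: u + v) = a *: val u + val v.
Proof. by []. Qed.

Let hsub_dot_bilinear : bilinear_for
  (GRing.Scale.Law.clone _ _ *%R _)
  (GRing.Scale.Law.clone _ _ (Num.conj \; *%R) _)
  hsub_dot.
Proof.
split=> u a v w; rewrite /hsub_dot val_hsubP/=.
  by rewrite hdotDl hdotZl.
by rewrite hdotDr hdotZr.
Qed.

HB.instance Definition _ := bilinear_isBilinear.Build R[i] (hsub S) (hsub S)
  R[i] _ _ hsub_dot hsub_dot_bilinear.

Let hsub_dot_herm u v :
  hsub_dot u v = (-1) ^+ false * Num.conj (hsub_dot v u).
Proof. exact: hermC. Qed.

HB.instance Definition _ := isHermitianSesquilinear.Build R[i] (hsub S) false
  Num.conj hsub_dot hsub_dot_herm.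

Let hsub_dot_gt0 u : u != 0 -> 0 < hsub_dot u u.
Proof. by move=> u0; rewrite /hsub_dot dnorm_gt0. Qed.

HB.instance Definition _ := isDotProduct.Build R[i] (hsub S) hsub_dot
  hsub_dot_gt0.

Let hsub_dot_norm (v : hsub S) : hsub_dot v v = `|v| ^+ 2.
Proof. exact: hdot_norm. Qed.

HB.instance Definition _ := isHilbert.Build R (hsub S) hsub_dot_norm.

Lemma hsub_hdotE (u v : hsub S) : hdot u v = hdot (val u) (val v).
Proof. by []. Qed.

Lemma hsub_sqnorm (v : hsub S) : sqnorm v = sqnorm (val v).
Proof. by []. Qed.

Lemma hsubP (v : hsub S) : csub_set S (val v).
Proof. exact/set_mem/valP. Qed.

Definition to_hsub v (Sv : csub_set S v) : hsub S :=
  exist (fun x : V => x \in csub_set S) v (mem_set Sv).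

End hsub.

Section hproj.
Variables (R : realType) (V : hilbertType R) (S : csub V).
Implicit Types (u v : V).

Let hproj_exists v : {p : hsub S | orthocomp S (v - val p)}.
Proof.
have [p Sp vp] := cid2 (orthogonal_decomposition v (csubP S)).
by exists (Sub p (mem_set Sp)); rewrite SubK.
Qed.

Definition hproj v : hsub S := sval (hproj_exists v).

Lemma hproj_ortho v : orthocomp S (v - val (hproj v)).
Proof. exact: svalP (hproj_exists v). Qed.

Lemma hproj_unique v (p : hsub S) : orthocomp S (v - val p) -> hproj v = p.
Proof.
move=> vp; apply/val_inj/eqP; rewrite -subr_eq0; apply/eqP/hdotvv_eq0.
have Sd : csub_set S (val (hproj v) - val p).
  by apply: closed_subspaceB; [exact: csubP|exact: hsubP|exact: hsubP].
rewrite -{1}[val (hproj v)](subKr v) addrAC hdotBl.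
by rewrite vp// hproj_ortho// subrr.
Qed.

Lemma val_hproj_unique v p :
  csub_set S p -> orthocomp S (v - p) -> val (hproj v) = p.
Proof.
move=> Sp vp.
by rewrite (@hproj_unique v (to_hsub Sp)).
Qed.

Lemma hproj_is_linear : linear hproj.
Proof.
move=> a u v; apply: hproj_unique; rewrite val_hsubP opprD addrACA -scalerBr.
have [_ _] := closed_subspace_orthocomp S; apply; exact: hproj_ortho.
Qed.

HB.instance Definition _ := GRing.isLinear.Build R[i] V (hsub S) *:%R hproj
  hproj_is_linear.

(** Self-adjointness of the projection, in the form used here. *)
Lemma hdot_hproj u v : csub_set S u -> hdot v u = hdot (val (hproj v)) u.
Proof.
move=> Su; rewrite -[in LHS](subrK (val (hproj v)) v) hdotDl.
by rewrite hproj_ortho ?add0r.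
Qed.

Lemma hproj_eq0P v : hproj v = 0 <-> orthocomp S v.
Proof.
split=> [v0 u Su|Sv]; first by rewrite hdot_hproj// v0 linear0l.
by apply: hproj_unique; rewrite subr0.
Qed.

(** Used to confine the closed span of [U], written as a double orthogonal
    complement, to any closed subspace containing [U]. *)
Lemma biorthocomp_sub (U : set V) :
  U `<=` csub_set S -> orthocomp (orthocomp U) `<=` csub_set S.
Proof.
move=> US v vU; pose d := v - val (hproj v).
have -> : v = val (hproj v); last exact: hsubP.
apply/eqP; rewrite -subr_eq0; apply/eqP/hdotvv_eq0; rewrite hdotBl -/d.
rewrite vU ?sub0r; last by move=> u /US; exact: hproj_ortho.
by rewrite (hdot0_sym (@hproj_ortho v _ (hsubP (hproj v)))) oppr0.
Qed.

End hproj.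

(** * Orthogonal families *)

Section finite_sums_in_esum.
Variables (R : realType) (J : choiceType) (D : set J) (a : J -> R).

Definition finite_in (r : seq J) := uniq r /\ forall j, j \in r -> D j.

Lemma sum_le_esum r : finite_in r ->
  ((\sum_(j <- r) a j)%:E <= \esum_(j in D) (a j)%:E)%E.
Proof.
move=> [r_uniq rD]; apply: ereal_sup_ubound; exists [set` r].
  by split; [exact: finite_seq|move=> j /= /rD].
by rewrite -fsbig_seq// sumEFin.
Qed.

Lemma esum_le_sum (M : \bar R) :
  (forall r, finite_in r -> ((\sum_(j <- r) a j)%:E <= M)%E) ->
  (\esum_(j in D) (a j)%:E <= M)%E.
Proof.
move=> aM; apply: ge_ereal_sup => _ [X [finX XD] <-].
rewrite fsbig_finite//= sumEFin; apply: aM; split=> // j.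
by rewrite in_fset_set// => /set_mem /XD.
Qed.

Lemma finite_in_sub r r' : finite_in r -> finite_in r' ->
  {subset r <= r'} -> exists2 t, finite_in t &
    forall (A : nmodType) (F : J -> A),
      \sum_(j <- r') F j = \sum_(j <- r) F j + \sum_(j <- t) F j.
Proof.
move=> [r_uniq rD] [r'_uniq r'D] rr'.
exists [seq j <- r' | j \notin r].
  by split; [exact: filter_uniq|move=> j; rewrite mem_filter => /andP[_ /r'D]].
move=> A F; rewrite -big_cat; apply: perm_big; apply: uniq_perm => //.
  rewrite cat_uniq r_uniq filter_uniq// andbT/=.
  by apply/hasPn => j; rewrite mem_filter => /andP[].
move=> j; rewrite mem_cat mem_filter; case: (boolP (j \in r)) => //= jr.
by rewrite rr'.
Qed.

End finite_sums_in_esum.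

Section orthogonal_family.
Variables (R : realType) (V : hilbertType R) (J : choiceType) (D : set J).
Variable S : J -> csub V.
Hypothesis S_ortho : forall i j, D i -> D j -> i <> j ->
  Defs.orthogonal (S i) (S j).

Implicit Types (w : forall j, hsub (S j)) (r : seq J) (v : V).

Let psum w r : V := \sum_(j <- r) val (w j).
Let sqsum w r : R := \sum_(j <- r) sqnorm (w j).

Let psum_ortho w r j : (forall i, i \in r -> D i) -> D j -> j \notin r ->
  orthocomp (S j) (psum w r).
Proof.
move=> rD Dj jr u Su; rewrite /psum linear_sumlz big_seq big1// => i ir /=.
apply: (S_ortho (rD _ ir) Dj) => //; last exact: hsubP.
by move=> ij; rewrite ij (negbTE jr) in ir.
Qed.

Let sqnorm_psum w r : finite_in D r -> sqnorm (psum w r) = sqsum w r.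
Proof.
rewrite /psum /sqsum; elim: r => [|j r IH] [/= r_uniq rD].
  by rewrite !big_nil sqnorm0.
move: r_uniq => /andP[jr r_uniq].
have rD' i : i \in r -> D i by move=> ir; apply: rD; rewrite inE ir orbT.
rewrite !big_cons pythagoras ?IH//.
apply: hdot0_sym; apply: psum_ortho (hsubP (w j)) => //.
by apply: rD; rewrite mem_head.
Qed.

Let psum_subr_ortho w r j : finite_in D r -> j \in r ->
  orthocomp (S j) (psum w r - val (w j)).
Proof.
move=> [r_uniq rD] jr; rewrite /psum (big_rem _ jr)/= addrAC subrr add0r.
apply: psum_ortho => [i /mem_rem/rD//||]; first exact: rD.
by rewrite mem_rem_uniq// !inE eqxx.
Qed.

Let bessel_eq v r : finite_in D r ->
  sqnorm v = sqnorm (v - psum (fun j => hproj (S j) v) r) +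
             sqsum (fun j => hproj (S j) v) r.
Proof.
move=> fr; set w := fun j => _; rewrite -sqnorm_psum// -pythagoras ?subrK//.
rewrite {2}/psum linear_sumr big_seq big1//= => j jr.
have := closed_subspaceB (closed_subspace_orthocomp (S j))
  (@hproj_ortho _ _ (S j) v) (psum_subr_ortho w fr jr).
by rewrite opprB addrA subrK; apply; exact: hsubP.
Qed.

(** Finite partial sums, ordered by inclusion, are Cauchy because the square
    norm of a difference of nested partial sums is a difference of sums of
    square norms. *)
Lemma orthogonal_synthesis w :
  (\esum_(j in D) (sqnorm (w j))%:E < +oo)%E ->
  exists2 v, forall j, D j -> hproj (S j) v = w j &
    (\esum_(j in D) (sqnorm (w j))%:E = (sqnorm v)%:E)%E.
Proof.
set E := (\esum_(j in D) _)%E => Efin.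
have E0 : (0 <= E)%E by apply: esum_ge0 => j _; rewrite lee_fin sqnorm_ge0.
have /fineK : E \is a fin_num by rewrite ge0_fin_numE.
set s := fine E => sE.
have sum_le r : finite_in D r -> sqsum w r <= s.
  by move=> /(sum_le_esum (fun j => sqnorm (w j))); rewrite -/E -sE lee_fin.
have sum_near e : 0 < e -> exists2 r, finite_in D r & s - e < sqsum w r.
  move=> e0; apply: contrapT => nr.
  suff : (E <= (s - e)%:E)%E by rewrite -sE lee_fin; lra.
  apply: esum_le_sum => r fr; rewrite lee_fin leNgt; apply/negP => h.
  by apply: nr; exists r.
have sub_dist r u : finite_in D r -> finite_in D u -> {subset r <= u} ->
    sqnorm (psum w r - psum w u) <= s - sqsum w r.
  move=> fr fu ru; have [t ft] := finite_in_sub fr fu ru; rewrite /psum /sqsum.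
  move=> tE; have := sum_le _ fu.
  rewrite /sqsum (tE V) (tE R) opprD addrA subrr add0r.
  by rewrite sqnormN sqnorm_psum// => h; rewrite lerBrDr addrC.
pose X := {r | finite_in D r}.
have [|||v vX] := @potential_limit _ _ X (fun x => psum w (sval x))
    (fun x => - sqsum w (sval x)) (- s).
- by move=> x; rewrite lerN2 sum_le//; exact: svalP.
- move=> e /sum_near[r fr rs]; exists (exist _ r fr) => /=; lra.
- move=> [r fr] [r' fr'] /=; pose u := undup (r ++ r').
  have fu : finite_in D u.
    split=> [|j]; first exact: undup_uniq.
    by rewrite mem_undup mem_cat => /orP[/fr.2|/fr'.2].
  have ru : {subset r <= u} by move=> j jr; rewrite mem_undup mem_cat jr.
  have r'u : {subset r' <= u} by move=> j jr; rewrite mem_undup mem_cat jr orbT.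
  have := sqnormD_le (psum w r - psum w u) (psum w u - psum w r').
  rewrite addrA subrK (sqnorm_distC (psum w u)) => h.
  by have := sub_dist _ _ fr fu ru; have := sub_dist _ _ fr' fu r'u; lra.
have vr r : finite_in D r -> sqnorm (psum w r - v) <= 4 * (s - sqsum w r).
  by move=> fr; have := vX (exist _ r fr) => /=; lra.
have vw j : D j -> hproj (S j) v = w j.
  move=> Dj; apply: hproj_unique.
  have [cS _ _] := closed_subspace_orthocomp (S j).
  move/closed_sqnormP : cS; apply => e e0; have e40 : 0 < e / 4 by lra.
  have [r fr rs] := sum_near _ e40; pose u := if j \in r then r else j :: r.
  have fu : finite_in D u.
    rewrite /u; case: ifPn => // jr; case: fr => r_uniq rD; split => /=.
      by rewrite jr.
    by move=> i; rewrite inE => /predU1P[->//|/rD].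
  have ju : j \in u by rewrite /u; case: ifPn => // _; exact: mem_head.
  have us : sqsum w r <= sqsum w u.
    rewrite /u; case: ifPn => // _; rewrite /sqsum big_cons lerDr.
    exact: sqnorm_ge0.
  exists (psum w u - val (w j)); first exact: psum_subr_ortho.
  rewrite opprB addrA subrK; apply: le_lt_trans (vr _ fu) _; lra.
exists v => //; rewrite -sE; congr EFin; apply/eqP; rewrite eq_le.
apply/andP; split; last first.
  apply: sqnorm_limit_le => e e0; have e40 : 0 < e / 4 by lra.
  have [r fr rs] := sum_near _ e40; exists (psum w r).
    by apply: le_lt_trans (vr _ fr) _; lra.
  by rewrite sqnorm_psum//; have := sum_le _ fr; lra.
apply/ler_addgt0Pl => e /sum_near[r fr rs].
suff : sqsum w r <= sqnorm v by lra.
rewrite (bessel_eq v fr) /sqsum [leRHS]addrC big_seq [X in _ <= X + _]big_seq.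
under [X in _ <= X + _]eq_bigr => j jr do rewrite (vw j (fr.2 j jr)).
by rewrite lerDl sqnorm_ge0.
Qed.

Lemma bessel v :
  (\esum_(j in D) (sqnorm (hproj (S j) v))%:E <= (sqnorm v)%:E)%E.
Proof.
apply: esum_le_sum => r fr.
by rewrite lee_fin (bessel_eq v fr) lerDr sqnorm_ge0.
Qed.

(** By Bessel's inequality the projections of [v] are summable; the vector
    synthesised from them has the same projections as [v], hence is [v] when the
    family is total. *)
Lemma parseval v : (forall u, (forall j, D j -> orthocomp (S j) u) -> u = 0) ->
  (\esum_(j in D) (sqnorm (hproj (S j) v))%:E = (sqnorm v)%:E)%E.
Proof.
move=> total.
have [|v' v'v ->] := orthogonal_synthesis (w := fun j => hproj (S j) v).
  by apply: le_lt_trans (bessel v) _; rewrite ltry.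
congr (sqnorm _)%:E; apply/eqP; rewrite -subr_eq0; apply/eqP/total => j Dj.
by apply/hproj_eq0P; rewrite linearB/= v'v// subrr.
Qed.

End orthogonal_family.

(** * Subrepresentations *)

Section subspaces_of_subspaces.
Variables (R : realType) (V : hilbertType R) (K : csub V).

Lemma closed_subspace_val_image (S : set (hsub K)) :
  closed_subspace S -> closed_subspace [set val u | u in S].
Proof.
move=> [/closed_sqnormP cS S0 SP]; split; last 2 first.
- by exists 0.
- by move=> a _ _ [u Su <-] [v Sv <-]; exists (a *: u + v) => //; exact: SP.
apply/closed_sqnormP => v vS.
have Kv : v \in csub_set K.
  apply/mem_set; have [/closed_sqnormP cK _ _] := csubP K; apply: cK => e /vS.
  by move=> [_ [u _ <-] ue]; exists (val u) => //; exact: hsubP.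
exists (Sub v Kv); last exact: SubK.
by apply: cS => e /vS[_ [u Su <-] ue]; exists u.
Qed.

Lemma closed_subspace_val_preimage (T : set V) :
  closed_subspace T -> closed_subspace [set u : hsub K | T (val u)].
Proof.
move=> [/closed_sqnormP cT T0 TP]; split; last 2 first.
- exact: T0.
- by move=> a u v Tu Tv; exact: TP.
apply/closed_sqnormP => v vT; apply: cT => e /vT[u Tu ue].
by exists (val u).
Qed.

End subspaces_of_subspaces.

Section unitary_rep_theory.
Variables (R : realType) (V : hilbertType R) (G : topologicalGroupType).
Variable pi : unitary_rep G V.
Implicit Types (g h : G) (u v : V).

Lemma rep_dot g u v : hdot (pi g u) (pi g v) = hdot u v.
Proof. exact: (rep_unitary pi g).2. Qed.

Lemma rep_sqnorm g v : sqnorm (pi g v) = sqnorm v.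
Proof. exact/sqnorm_unitary/rep_unitary. Qed.

Lemma rep1 v : pi 1%g v = v.
Proof.
have [/bij_inj inj _] := rep_unitary pi 1%g.
by apply: inj; rewrite -repM mulg1.
Qed.

Lemma repK g : cancel (pi g) (pi g^-1%g).
Proof. by move=> v; rewrite -repM mulVg rep1. Qed.

Lemma repVK g : cancel (pi g^-1%g) (pi g).
Proof. by move=> v; rewrite -repM mulgV rep1. Qed.

Lemma rep_dotl g u v : hdot (pi g u) v = hdot u (pi g^-1%g v).
Proof. by rewrite -(rep_dot g^-1%g) repK. Qed.

Lemma closed_subspace_translate g (S : set V) :
  closed_subspace S -> closed_subspace [set v | S (pi g^-1%g v)].
Proof.
move=> [/closed_sqnormP cS S0 SP]; split; last 2 first.
- by rewrite /= linear0.
- by move=> a u v /= Su Sv; rewrite linearP; exact: SP.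
apply/closed_sqnormP => v vS; apply: cS => e /vS[u Su ue].
by exists (pi g^-1%g u) => //; rewrite -linearB rep_sqnorm.
Qed.

Definition translate g (K : csub V) : csub V :=
  CSub (closed_subspace_translate g (csubP K)).

(** The projection onto [pi g K] is the conjugate by [pi g] of the projection
    onto [K]. *)
Lemma hproj_translate g (K : csub V) v :
  val (hproj (translate g K) v) = pi g (val (hproj K (pi g^-1%g v))).
Proof.
apply: val_hproj_unique => [|u Ku]; first by rewrite /= repK; exact: hsubP.
rewrite -{1}(repVK g v) -linearB rep_dotl; exact: hproj_ortho.
Qed.

Lemma hproj_rep g (K : csub V) v :
  (forall u, csub_set K u -> csub_set K (pi g u)) ->
  (forall u, csub_set K u -> csub_set K (pi g^-1%g u)) ->
  val (hproj K (pi g v)) = pi g (val (hproj K v)).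
Proof.
move=> Kg Kg'; apply: val_hproj_unique => [|u Ku]; first exact/Kg/hsubP.
by rewrite -linearB rep_dotl; apply: hproj_ortho; exact: Kg'.
Qed.

Lemma closed_subspace_invariants (S : set G) :
  closed_subspace (invariants pi S).
Proof.
split; last 2 first.
- by move=> g _; rewrite linear0.
- by move=> a u v uS vS g Sg; rewrite linearP/= uS// vS.
apply/closed_sqnormP => v vS g Sg; apply/eqP; rewrite -subr_eq0 -sqnorm_eq0.
rewrite eq_le sqnorm_ge0 andbT; apply/ler_addgt0Pl => e e0; rewrite addr0.
have [|u uS uv] := vS (e / 4); first by rewrite divr_gt0.
have := sqnormD_le (pi g v - u) (u - v); rewrite addrA subrK.
have -> : sqnorm (pi g v - u) = sqnorm (u - v).
  by rewrite -{1}(uS g Sg) -linearB rep_sqnorm sqnorm_distC.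
by lra.
Qed.

End unitary_rep_theory.

(** Restrictions to invariant subspaces are needed for the group itself and for
    its setwise stabilizers; pulling back along a continuous morphism [phi] covers
    both. *)
Section subrep.
Variables (R : realType) (V : hilbertType R) (G G' : topologicalGroupType).
Variables (phi : G' -> G) (pi : unitary_rep G V) (S : csub V).
Hypothesis phiM : {morph phi : g h / (g * h)%g}.
Hypothesis phi_cont : continuous phi.
Hypothesis S_inv : forall g v, csub_set S v -> csub_set S (pi (phi g) v).

Definition subrep_fun (g : G') (v : hsub S) : hsub S :=
  Sub (pi (phi g) (val v)) (mem_set (S_inv g (hsubP v))).

Lemma val_subrep g v : val (subrep_fun g v) = pi (phi g) (val v).
Proof. exact: SubK. Qed.

Let subrep_linear g : linear (subrep_fun g).
Proof.
by move=> a u v; apply: val_inj; rewrite !val_subrep !val_hsubP linearP.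
Qed.

HB.instance Definition _ g := GRing.isLinear.Build R[i] (hsub S) (hsub S) *:%R
  (subrep_fun g) (subrep_linear g).

Let subrep_lin g : {linear hsub S -> hsub S} := subrep_fun g.

Let phi1 : phi 1%g = 1%g.
Proof. by apply: (@mulgI _ (phi 1%g)); rewrite -phiM !mulg1. Qed.

Let subrep_unitary g : unitary (subrep_lin g).
Proof.
split; last by move=> u v; rewrite !hsub_hdotE !val_subrep rep_dot.
exists (subrep_fun g^-1%g) => v; apply: val_inj;
  by rewrite !val_subrep -repM -phiM ?mulVg ?mulgV phi1 rep1.
Qed.

Let subrepM g h v : subrep_lin (g * h)%g v = subrep_lin g (subrep_lin h v).
Proof. by apply: val_inj; rewrite !val_subrep phiM repM. Qed.

Let subrep_continuous v : continuous (fun g => subrep_lin g v).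
Proof.
move=> g U /nbhs_sqnorm[e e0 eU].
set w := pi (phi g) (val v).
have /(@rep_continuous _ _ _ pi (val v) (phi g)) :
    nbhs w [set u | sqnorm (u - w) < e].
  by apply/nbhs_sqnorm; exists e.
move=> /phi_cont.
rewrite nbhs_simpl => gU.
have {}gU : nbhs g [set x | sqnorm (pi (phi x) (val v) - w) < e] by [].
suff : nbhs g [set x | U (subrep_lin x v)] by [].
by apply: filterS gU => x xe; apply: eU.
Qed.

Definition subrep : unitary_rep G' (hsub S) :=
  UnitaryRep subrep_unitary subrepM subrep_continuous.

Lemma val_subrepE g v : val (subrep g v) = pi (phi g) (val v).
Proof. exact: val_subrep. Qed.

End subrep.

(** * Recognising induced representations *)

Section induced_criterion.
Variables (R : realType) (V : hilbertType R) (G : topologicalGroupType).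
Variables (pi : unitary_rep G V) (H : subgroup G) (K : csub V).
Hypothesis K_inv : forall (h : H) v, csub_set K v -> csub_set K (pi (val h) v).

Let valM : {morph (val : H -> G) : g h / (g * h)%g}.
Proof. by []. Qed.

Let val_cont : continuous (val : H -> G).
Proof. exact: (@initial_continuous _ _ (set_val : H -> G)). Qed.

Definition stabilizer_rep : unitary_rep H (hsub K) :=
  subrep valM val_cont K_inv.

Hypothesis K_ortho : forall g, ~ subgroup_set H g ->
  forall u v, csub_set K u -> csub_set K v -> hdot u (pi g v) = 0.
Hypothesis K_total : forall v,
  (forall g, orthocomp (translate pi g K) v) -> v = 0.

Let inH h (Hh : subgroup_set H h) : H := exist _ h (mem_set Hh).

Let K_invP h v : subgroup_set H h -> csub_set K v -> csub_set K (pi h v).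
Proof. by move=> Hh; exact: (K_inv (inH Hh)). Qed.

Let coset_rep q : left_cosets H q -> q (xget 1%g q).
Proof.
move=> [g _ <-]; apply: xgetPex.
by exists (g * 1)%g, 1%g => //; exact: subgroup1.
Qed.

Let left_coset_eq q g : left_cosets H q -> q g ->
  q = [set (g * h)%g | h in (H : set G)].
Proof.
move=> [g0 _ <-] [h0 Hh0 <-]; apply/seteqP; split=> _ [h Hh <-].
  exists (h0^-1 * h)%g; last by rewrite -mulgA mulVKg.
  by apply: subgroupM => //; exact: subgroupV.
by exists (h0 * h)%g; [exact: subgroupM|rewrite mulgA].
Qed.

Let S (q : set G) : csub V := translate pi (xget 1%g q) K.

Let S_ortho q q' : left_cosets H q -> left_cosets H q' -> q <> q' ->
  Defs.orthogonal (S q) (S q').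
Proof.
move=> Dq Dq' qq' u v /= Ku Kv.
set g := xget _ q in Ku *; set g' := xget _ q' in Kv *.
rewrite -(repVK pi g u) -(repVK pi g' v) rep_dotl -repM.
apply: K_ortho => // Hg; apply: qq'.
have qg' : q g'.
  rewrite (left_coset_eq Dq (coset_rep Dq)); exists (g^-1 * g')%g => //.
  by rewrite mulVKg.
by rewrite (left_coset_eq Dq qg') -(left_coset_eq Dq' (coset_rep Dq')).
Qed.

Let S_total v : (forall q, left_cosets H q -> orthocomp (S q) v) -> v = 0.
Proof.
move=> vS; apply: K_total => g u /= Ku.
pose q := [set (g * h)%g | h in (H : set G)].
have Dq : left_cosets H q by exists g.
apply: (vS q) => //=.
have [h Hh <-] := coset_rep Dq.
by rewrite invgM repM; apply: K_invP => //; exact: subgroupV.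
Qed.

(** The [K]-component of [pi g^-1 v] is the component of [v] in [pi g K], moved
    back to [K]. *)
Definition coset_map (v : V) : G -> hsub K := fun g => hproj K (pi g^-1%g v).

Let coset_map_linear : linear coset_map.
Proof. by move=> a u v; apply/funext => g; rewrite /coset_map !linearP. Qed.

HB.instance Definition _ := GRing.isLinear.Build R[i] V (G -> hsub K) *:%R
  coset_map coset_map_linear.

Let coset_map_equivariant v : equivariant stabilizer_rep (coset_map v).
Proof.
move=> g h; apply: val_inj; rewrite val_subrepE /coset_map invgM repM.
have Hh : subgroup_set H (val h) by exact/set_mem/valP.
apply: hproj_rep => u Ku; apply: K_invP => //; first exact: subgroupV.
by rewrite invgK.
Qed.

Let coset_map_sqnorm v q :
  coset_sqnorm (coset_map v) q = sqnorm (hproj (S q) v).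
Proof.
by rewrite [RHS]hsub_sqnorm hproj_translate rep_sqnorm.
Qed.

Let ind_sqnorm_coset_map v : ind_sqnorm H (coset_map v) = (sqnorm v)%:E.
Proof.
rewrite -(parseval S_ortho v S_total); apply: eq_esum => q _.
by rewrite coset_map_sqnorm.
Qed.

(** If the translates of [K] along the cosets of its stabilizer are orthogonal and
    total, the representation is induced from that stabilizer: norms match by
    Parseval's identity, and a square-summable equivariant function is synthesised
    from its values at coset representatives. *)
Lemma iso_induced_stabilizer : iso_induced stabilizer_rep pi.
Proof.
exists (coset_map : {linear V -> (G -> hsub K)}); split; last 2 first.
- exact: ind_sqnorm_coset_map.
- move=> g v; apply/funext => x.
  by rewrite /ind_act /= /coset_map invgM invgK repM.
apply/seteqP; split=> [_ [v _ <-]|f [f_equiv f_fin]].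
  split; first exact: coset_map_equivariant.
  by rewrite /= ind_sqnorm_coset_map ltry.
have w_mem q : csub_set (S q) (pi (xget 1%g q) (val (f (xget 1%g q)))).
  by rewrite /= repK; exact: hsubP.
pose w q : hsub (S q) := to_hsub (w_mem q).
have wE q : val (w q) = pi (xget 1%g q) (val (f (xget 1%g q))) by [].
have [|v vw _] := orthogonal_synthesis S_ortho (w := w).
  rewrite (_ : esum _ _ = ind_sqnorm H f)//; apply: eq_esum => q _.
  by rewrite [in LHS]hsub_sqnorm wE rep_sqnorm.
exists v => //; apply/funext => g.
pose q := [set (g * h)%g | h in (H : set G)].
have Dq : left_cosets H q by exists g.
have := coset_rep Dq; set g' := xget 1%g q => qg'.
have [h Hh gE] : [set (g' * h)%g | h in (H : set G)] g.
  by rewrite -(left_coset_eq Dq qg'); exists 1%g; [exact: subgroup1|exact: mulg1].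
have fg' : coset_map v g' = f g'.
  apply: val_inj; apply: (can_inj (repK pi g')).
  by rewrite -hproj_translate -/(S q) -wE -(vw q Dq).
have := coset_map_equivariant v g' (inH Hh).
by rewrite fg' -(f_equiv g' (inH Hh)) -gE.
Qed.

End induced_criterion.

(** * Irreducibility and fixed vectors *)

Section irreducibility_criterion.
Variables (R : realType) (V : hilbertType R) (G : topologicalGroupType).
Variables (pi : unitary_rep G V) (H : subgroup G) (K : csub V).
Hypothesis K_inv : forall (h : H) v, csub_set K v -> csub_set K (pi (val h) v).
Hypothesis K_neq0 : exists2 v, csub_set K v & v != 0.
Hypothesis K_irr : forall T : set V, closed_subspace T -> T `<=` csub_set K ->
  (forall (h : H) v, T v -> T (pi (val h) v)) -> T `<=` [set 0] \/ K `<=` T.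

Let subset0_eq (U : hilbertType R) (T : set U) :
  closed_subspace T -> T `<=` [set 0] -> T = [set 0].
Proof. by move=> [_ T0 _] T_0; apply/seteqP; split => // _ ->. Qed.

Lemma irreducible_stabilizer_rep : irreducible (stabilizer_rep K_inv).
Proof.
split.
  have [v Kv v0] := K_neq0; exists (to_hsub Kv).
  by apply: contra_neq v0 => /(congr1 val).
move=> S cS S_inv.
have [||S0|KS] := K_irr (closed_subspace_val_image cS).
- by move=> _ [u _ <-]; exact: hsubP.
- move=> h _ [u Su <-]; exists (stabilizer_rep K_inv h u); first exact: S_inv.
  exact: val_subrepE.
- left; apply: subset0_eq => // u Su; apply: val_inj; apply: S0.
  by exists u.
- right; apply/seteqP; split => // u _.
  by have [w Sw /val_inj <-] := KS _ (hsubP u).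
Qed.

Variable N : set G.
Hypothesis K_invariants : invariants pi N = K.
Hypothesis K_total : forall v,
  (forall g, orthocomp (translate pi g K) v) -> v = 0.

(** Projecting onto an invariant subspace [T] commutes with the group, so it maps
    [K], the space of all [N]-fixed vectors, into the intersection of [T] and [K].
    If this intersection is zero, [T] is orthogonal to all translates of [K];
    otherwise it is [K], and the translates of [K] lie in [T]. *)
Lemma irreducible_of_invariants : irreducible pi.
Proof.
split; first by have [v _ v0] := K_neq0; exists v.
move=> T cT T_inv; pose cs := CSub cT.
have [||TK0|KT] := K_irr (closed_subspaceI cT (csubP K)).
- by move=> v [].
- by move=> h v [Tv Kv]; split; [exact: T_inv|exact: K_inv].
- left; apply: subset0_eq => // v Tv; apply: K_total => g u /= Ku.
  rewrite -(repVK pi g u) -(invgK g) -rep_dotl.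
  apply/hdot0_sym; have /hproj_eq0P Tu : hproj cs (pi g^-1%g u) = 0.
    apply: val_inj; apply: TK0; split; first exact: (hsubP (hproj cs _)).
    rewrite -K_invariants => h Nh.
    rewrite -hproj_rep; [|by move=> x; exact: T_inv..].
    by move: Ku; rewrite -K_invariants => ->.
  by rewrite invgK; apply: Tu; exact: T_inv.
- right; apply/seteqP; split => // v _.
  suff /eqP : v - val (hproj cs v) = 0.
    by rewrite subr_eq0 => /eqP ->; exact: (hsubP (hproj cs v)).
  apply: K_total => g u /= Ku; apply: (@hproj_ortho _ _ cs).
  by rewrite -(repVK pi g u); apply/T_inv/(KT _ Ku).1.
Qed.

End irreducibility_criterion.

Section fixed_vectors.
Variables (R : realType) (V : hilbertType R) (G : topologicalGroupType).
Variables (pi : unitary_rep G V).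

Lemma closed_halfspace (w : V) (c : R) : closed [set u | c <= rdot u w].
Proof.
apply/closed_sqnormP => v vC /=; rewrite leNgt; apply/negP => vc.
pose d := c - rdot v w; have d0 : 0 < d by rewrite subr_gt0.
pose M := sqnorm w; have M0 : 0 <= M := sqnorm_ge0 w.
have [|u /= uc uv] := vC (d ^+ 2 / (M + 1)).
  by rewrite divr_gt0 ?exprn_gt0//; lra.
have := rdot_cauchy_schwarz (u - v) w; rewrite -/M => cs.
have dw : d ^+ 2 <= rdot (u - v) w ^+ 2.
  by rewrite lerXn2r ?nnegrE ?rdotBl /d; lra.
have : sqnorm (u - v) * M <= d ^+ 2 / (M + 1) * M by rewrite ler_wpM2r// ltW.
have : d ^+ 2 / (M + 1) * M < d ^+ 2.
  by rewrite mulrAC ltr_pdivrMr ?ltr_pM2l ?exprn_gt0//; lra.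
by lra.
Qed.

(** The vector is the point of least norm of the set of all [u] in [S] that
    have large inner product with the whole [N]-orbit of [v]: this set is closed,
    convex, [N]-invariant and avoids the origin. *)
Lemma invariant_vector (N : subgroup G) (S : set V) v :
  closed_subspace S -> (forall g u, S u -> S (pi g u)) -> S v -> v != 0 ->
  (forall g, subgroup_set N g -> sqnorm (pi g v - v) <= sqnorm v) ->
  exists2 u, S u /\ invariants pi N u & u != 0.
Proof.
move=> cS S_inv Sv v0 Nv; pose c := sqnorm v / 2.
pose C : set V :=
  S `&` \bigcap_(g in (N : set G)) [set u | c <= rdot u (pi g v)].
have cC : closed C.
  apply: closedI; first by case: cS.
  by apply: closed_bigI => g _; exact: closed_halfspace.
have Cv : C v.
  split=> // g /Nv /=; rewrite sqnorm_distC sqnormB rep_sqnorm /c.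
  by have := sqnorm_ge0 v; lra.
have midC x y : C x -> C y -> C ((2^-1)%:C *: (x + y)).
  move=> [Sx Cx] [Sy Cy]; split.
    by apply: closed_subspaceZ => //; exact: closed_subspaceD.
  move=> g Ng /=; rewrite rdotZl rdotDl.
  by have := Cx g Ng; have := Cy g Ng => /=; lra.
have [|x Cx x_min] := min_norm_point cC _ midC; first by exists v.
have [Sx xv] := Cx.
exists x; last first.
  apply/eqP => x0; have := xv 1%g (subgroup1 N).
  rewrite /= x0 /rdot linear0l/= /c.
  have := sqnorm_ge0 v; rewrite le_eqVlt eq_sym sqnorm_eq0 (negbTE v0)/=; lra.
split=> // g Ng.
have /x_min [_] : C (pi g x).
  split=> [|h Nh /=]; first exact: S_inv.
  rewrite /rdot rep_dotl -repM; apply: (xv (g^-1 * h)%g).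
  by apply: subgroupM => //; exact: subgroupV.
by rewrite rep_sqnorm eqxx => /esym/eqP.
Qed.

End fixed_vectors.

(** * Irreducible subspaces generated by finite orbits *)

Lemma exists_minimal (T : Type) (m : T -> nat) (Q : T -> Prop) :
  (exists x, Q x) -> exists2 x, Q x & forall y, Q y -> (m x <= m y)%N.
Proof.
move=> [x]; have [n] := ubnP (m x); elim: n x => // n IH x xn Qx.
have [xmin|/existsNP[y /not_implyP[Qy /negP yx]]] :=
  pselect (forall y, Q y -> (m x <= m y)%N); first by exists x.
apply: (IH y) => //; move: xn yx; rewrite -ltnNge ltnS => /[swap].
exact: leq_trans.
Qed.

Section finite_orbit.
Variables (R : realType) (V : hilbertType R) (G : topologicalGroupType).
Variables (pi : unitary_rep G V) (H : subgroup G).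

Definition stable (T : set V) := forall (h : H) v, T v -> T (pi (val h) v).

(** The least size of a separating list is the dimension of [T], used here without
    bases. *)
Definition separates (l : seq V) (T : set V) :=
  forall u, T u -> (forall x, x \in l -> hdot u x = 0) -> u = 0.

(** Strict monotonicity of dimension, by exchange: some [x] of the list is not
    orthogonal to [w]; subtracting multiples of [x] makes the other members
    orthogonal to [w], and then [x] can be dropped. *)
Lemma separates_proper (l : seq V) (T T' : set V) w :
  closed_subspace T -> T' `<=` T -> T w -> w != 0 -> orthocomp T' w ->
  separates l T -> exists2 l', (size l' < size l)%N & separates l' T'.
Proof.
move=> cT T'T Tw w0 wT' sep.
have [x xl wx] : exists2 x, x \in l & hdot w x != 0.
  apply: contrapT => nx; move/eqP : w0; apply; apply: sep => // x xl.
  by apply/eqP/negP => /negP wx; apply: nx; exists x.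
pose c y := Num.conj (hdot w y / hdot w x).
have wc y : hdot w (y - c y *: x) = 0.
  by rewrite hdotBr hdotZr conjCK divfK ?subrr.
exists [seq y - c y *: x | y <- rem x l].
  by rewrite size_map size_rem//; case: (l) xl.
move=> u T'u ul; pose t := hdot u x / hdot w x.
have u_tw : u = t *: w.
  apply/eqP; rewrite -subr_eq0; apply/eqP/sep.
    by apply: closed_subspaceB => //; [exact: T'T|exact: closed_subspaceZ].
  have ux : hdot (u - t *: w) x = 0.
    by rewrite hdotBl hdotZl divfK ?subrr.
  move=> y yl; have [->//|yx] := eqVneq y x.
  rewrite -[y](subrK (c y *: x)) hdotDr [hdot _ (c y *: x)]hdotZr ux mulr0 addr0.
  rewrite hdotBl hdotZl wc mulr0 subr0; apply: ul.
  apply/mapP; exists y => //.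
  by move: yl; rewrite (perm_mem (perm_to_rem xl)) inE (negbTE yx).
apply: hdotvv_eq0; rewrite {2}u_tw hdotZr.
by rewrite (hdot0_sym (wT' _ T'u)) mulr0.
Qed.

(** The closed span of a finite orbit is stable and separated by that orbit; among
    nonzero stable subspaces, one separated by a shortest list is irreducible,
    since a proper subspace would be separated by a shorter one. *)
Lemma exists_irreducible (S : set V) v (l : seq V) :
  closed_subspace S -> stable S -> S v -> v != 0 ->
  (forall h : H, pi (val h) v \in l) ->
  exists K : csub V, [/\ csub_set K `<=` S, stable K,
    exists2 v, csub_set K v & v != 0 &
    forall T : set V, closed_subspace T -> T `<=` csub_set K -> stable T ->
      T `<=` [set 0] \/ K `<=` T].
Proof.
move=> cS S_st Sv v0 vl.
pose Q (Tl : csub V * seq V) := [/\ csub_set Tl.1 `<=` S, stable Tl.1,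
  exists2 v, csub_set Tl.1 v & v != 0 & separates Tl.2 (csub_set Tl.1)].
pose O : set V := range (fun h : H => pi (val h) v).
pose T0 : csub V := CSub (closed_subspaceI cS
  (closed_subspace_orthocomp (orthocomp O))).
have QT0 : Q (T0, l).
  split=> /=.
  - by move=> u [].
  - move=> h u [Su uO]; split; first exact: S_st.
    move=> x xO; rewrite rep_dotl; apply: uO => _ [k _ <-].
    by rewrite rep_dotl invgK -repM; apply: xO; exists (h * k)%g.
  - exists v => //; split=> // x xO; apply: hdot0_sym; apply: xO.
    by exists 1%g => //; exact: rep1.
  - move=> u [_ uO] ul; apply: hdotvv_eq0.
    by rewrite uO// => _ [h _ <-]; apply: ul.
have [|[K k] [/= KS K_st K0 kK] K_min] :=
  exists_minimal (fun x => size x.2) (Q := Q).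
  by exists (T0, l).
exists K; split=> // T cT TK T_st.
have [|T0'] := pselect (T `<=` [set 0]); [by left|right].
apply: contrapT => KT.
have [u Ku Tu] : exists2 u, csub_set K u & ~ T u.
  apply: contrapT => nu; apply: KT => u Ku.
  by apply: contrapT => Tu; apply: nu; exists u.
pose cs := CSub cT; pose w := u - val (hproj cs u).
have Tp : T (val (hproj cs u)) := hsubP (hproj cs u).
have [|||l' l'k l'T] := separates_proper (csubP K) TK (w := w) _ _ _ kK.
- by apply: closed_subspaceB => //; [exact: csubP|exact: TK].
- by apply: contra_notN Tu; rewrite subr_eq0 => /eqP ->.
- exact: (@hproj_ortho _ _ cs).
have : Q (cs, l').
  split=> //=; first exact: subset_trans KS.
  apply: contrapT => nT; apply: T0' => z Tz; apply: contrapT => z0; apply: nT.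
  by exists z => //; exact/eqP.
by move=> /K_min/=; rewrite leqNgt l'k.
Qed.

End finite_orbit.

(** * Stabilizers and dissociation *)

Section stabilizers.
Variables (Omega : choiceType) (G : subgroup (sym Omega)).
Implicit Types (A B : {fset Omega}) (g h : G).

Local Notation stab A := (pointwise_stab G [set` A]).
Local Notation set_stab A := (setwise_stab G [set` A]).

(** The sets containing some pointwise stabilizer form a filter, and this filter
    converges pointwise to the identity. *)
Lemma nbhs1_pointwise_stab (U : set G) : nbhs (1%g : G) U ->
  exists A, forall g, subgroup_set (stab A) g -> U g.
Proof.
pose F := filter_from [set: {fset Omega}]
  (fun A => [set s : sym Omega | forall a, a \in A -> s a = a]).
have FF : Filter F.
  apply: filter_from_filter; first by exists fset0.
  move=> A B _ _; exists (A `|` B)%fset => // s sAB.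
  by split=> a aA; apply: sAB; rewrite inE aA ?orbT.
have F1 : F --> (1%g : sym Omega).
  by apply/cvg_symP => a; exists [fset a]%fset => // s /(_ a); apply; rewrite inE.
move=> [V [[W oW <-] W1] VU].
have /F1[A _ AW] : nbhs (1%g : sym Omega) W by exact: open_nbhs_nbhs.
exists A => g gA; apply: VU; apply: AW => a aA; exact: gA.
Qed.

(** The finite quotient of the setwise stabilizer by the pointwise one, seen
    through its action on [A]. *)
Lemma finite_set_stab_action A : exists f : set_stab A -> {ffun A -> A},
  forall h k : set_stab A, f h = f k ->
    subgroup_set (stab A) ((val h)^-1 * val k)%g.
Proof.
have hA (h : set_stab A) (a : A) : gact (val h) (val a) \in A.
  have := set_mem (valP h) : gact (val h) @` [set` A] = [set` A].
  by move=> /seteqP[+ _]; apply; exists (val a) => //; exact: valP.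
exists (fun h : set_stab A => [ffun a : A => [` hA h a]%fset]).
move=> h k /ffunP hk a /= aA.
have := hk [` aA]%fset; rewrite !ffunE => /(congr1 val)/= hka.
by rewrite gactM -hka gactK.
Qed.

End stabilizers.

Section dissociated_subreps.
Variables (R : realType) (Omega : choiceType) (G : subgroup (sym Omega)).
Variables (V : hilbertType R) (pi : unitary_rep G V).
Hypothesis pi_diss : dissociated pi.
Implicit Types (A B : {fset Omega}) (g h : G).

Local Notation stab A := (pointwise_stab G [set` A]).
Local Notation set_stab A := (setwise_stab G [set` A]).

(** By continuity, [v] is moved by less than its norm by the elements of a
    neighbourhood of the identity, hence by some stabilizer. *)
Lemma exists_stab_invariant (S : set V) v : closed_subspace S ->
  (forall g u, S u -> S (pi g u)) -> S v -> v != 0 ->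
  exists A, exists2 u, S u /\ invariants pi (stab A) u & u != 0.
Proof.
move=> cS S_inv Sv v0.
have /nbhs1_pointwise_stab[A Av] :
    nbhs (1%g : G) [set g | sqnorm (pi g v - pi 1%g v) < sqnorm v].
  apply: (@rep_continuous _ _ _ pi v 1%g
    [set w | sqnorm (w - pi 1%g v) < sqnorm v]).
  apply/nbhs_sqnorm; exists (sqnorm v) => //.
  by rewrite lt_def sqnorm_eq0 v0 sqnorm_ge0.
exists A; apply: (@invariant_vector _ _ _ pi (stab A) S v) => // g gA.
by have := Av g gA; rewrite /= rep1 => /ltW.
Qed.

(** The stabilizer of [g A] is the conjugate by [g] of the stabilizer of [A]. *)
Lemma invariants_conj A g v : invariants pi (stab A) v ->
  invariants pi (pointwise_stab G (gact g @` [set` A])) (pi g v).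
Proof.
move=> vA h hA; have : subgroup_set (stab A) (g^-1 * h * g)%g.
  move=> a aA; rewrite !gactM; have -> : gact h (gact g a) = gact g a.
    by apply: hA; exists a.
  exact: gactK.
by move=> /vA e; rewrite -[in RHS]e -!repM !mulgA mulgV mul1g.
Qed.

Section minimal_support.
Variables (S : csub V) (A : {fset Omega}).
Hypothesis S_inv : forall g v, csub_set S v -> csub_set S (pi g v).
Hypothesis A_min : forall B, (#|` B| < #|` A|)%N ->
  forall v, csub_set S v -> invariants pi (stab B) v -> v = 0.

(** Dissociation makes the two spaces orthogonal relatively to the vectors fixed
    by the stabilizer of the intersection, and minimality leaves no such vector
    in [S]. *)
Lemma minimal_support_ortho g u v : ~ subgroup_set (set_stab A) g ->
  csub_set S u -> invariants pi (stab A) u ->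
  csub_set S v -> invariants pi (stab A) v -> hdot u (pi g v) = 0.
Proof.
move=> gA Su uA Sv vA.
pose gA' := [fset gact g x | x in A]%fset.
have gA'E : [set` gA'] = gact g @` [set` A].
  apply/seteqP; split=> x /=.
    by move=> /imfsetP[a /= aA ->]; exists a.
  by move=> [a aA <-]; apply/imfsetP; exists a.
pose B := (A `&` gA')%fset.
have BE : [set` B] = [set` A] `&` [set` gA'].
  by apply/seteqP; split=> x /=; rewrite inE => /andP.
have gact_inj : injective (gact g) := can_inj (gactK g).
have BA : (#|` B| < #|` A|)%N.
  rewrite fproper_ltn_card// fproperEneq fsubsetIl andbT.
  apply: contra_notN gA => /eqP BA; rewrite /= -gA'E; suff -> : gA' = A by [].
  apply/esym/eqP; rewrite eqEfcard card_imfset//= leqnn andbT.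
  by rewrite -[X in (X `<=` _)%fset]BA fsubsetIr.
have B0 x : csub_set S x -> orthocomp (invariants pi (stab B)) x.
  move=> Sx z zB; apply: hdot0_sym; rewrite (hdot_hproj z Sx).
  rewrite (A_min BA (hsubP (hproj S z))) ?linear0l// => h hB.
  by rewrite -hproj_rep; [rewrite zB|exact: S_inv|exact: S_inv].
apply: (pi_diss (finite_fset A) (finite_fset gA')); rewrite -BE.
  by split=> //; exact: B0.
by split; [rewrite gA'E; exact: invariants_conj|apply: B0; exact: S_inv].
Qed.

End minimal_support.
End dissociated_subreps.

(** * Existence of induced irreducible subrepresentations *)

Section global_subrep.
Variables (R : realType) (V : hilbertType R) (G : topologicalGroupType).
Variables (pi : unitary_rep G V) (W : csub V).
Hypothesis W_inv : forall g v, csub_set W v -> csub_set W (pi g v).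

Let idM : {morph (@id G) : g h / (g * h)%g}. Proof. by []. Qed.

Let id_cont : continuous (@id G). Proof. by move=> g; exact: cvg_id. Qed.

Definition global_subrep : unitary_rep G (hsub W) := subrep idM id_cont W_inv.

Lemma val_global_subrep g v : val (global_subrep g v) = pi g (val v).
Proof. exact: val_subrepE. Qed.

End global_subrep.

Section existence.
Variables (R : realType) (Omega : choiceType) (G : subgroup (sym Omega)).
Implicit Types (A B : {fset Omega}) (g h : G).

Local Notation stab A := (pointwise_stab G [set` A]).
Local Notation set_stab A := (setwise_stab G [set` A]).

Definition induced_from_finite (W : hilbertType R) (rho : unitary_rep G W) :=
  exists (A : set Omega) (K : hilbertType R)
         (sigma : unitary_rep (setwise_stab G A) K),
    [/\ finite_set A,
        irreducible sigma,
        factors_through sigma [set h | (pointwise_stab G A : set G) (val h)]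
      & iso_induced sigma rho].

Lemma irreducible_induced (W : hilbertType R) (rho : unitary_rep G W)
    (A : {fset Omega}) (K : csub W)
    (K_inv : forall (h : set_stab A) v, csub_set K v ->
      csub_set K (rho (val h) v)) :
  (exists2 v, csub_set K v & v != 0) ->
  (forall T : set W, closed_subspace T -> T `<=` csub_set K ->
     (forall (h : set_stab A) v, T v -> T (rho (val h) v)) ->
     T `<=` [set 0] \/ K `<=` T) ->
  invariants rho (stab A) = K ->
  (forall v, (forall g, orthocomp (translate rho g K) v) -> v = 0) ->
  (forall g, ~ subgroup_set (set_stab A) g -> forall u v,
     csub_set K u -> csub_set K v -> hdot u (rho g v) = 0) ->
  irreducible rho /\ induced_from_finite rho.
Proof.
move=> K0 K_irr K_fix K_total K_ortho.
split; first exact: (irreducible_of_invariants K_inv K0 K_irr K_fix K_total).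
exists [set` A], (hsub K), (stabilizer_rep K_inv); split.
- exact: finite_fset.
- exact: irreducible_stabilizer_rep.
- move=> h k hk v; apply: val_inj; rewrite !val_subrepE.
  have vA : invariants rho (stab A) (val v) by rewrite K_fix; exact: hsubP.
  have hkv : rho ((val h)^-1 * val k)%g (val v) = val v by exact: (vA _ hk).
  by rewrite -[in LHS]hkv -repM mulVKg.
- exact: iso_induced_stabilizer.
Qed.

Variables (V : hilbertType R) (pi : unitary_rep G V).
Hypothesis pi_diss : dissociated pi.

(** Take [A] of least size among the finite sets whose stabilizer fixes a nonzero
    vector of [S], an irreducible space [K] of such vectors for the setwise
    stabilizer, and the closed span [W] of its translates. *)
Lemma exists_induced_subrep (S : csub V) :
  (forall g v, csub_set S v -> csub_set S (pi g v)) ->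
  (exists2 v, csub_set S v & v != 0) ->
  exists W : csub V,
  exists W_inv : forall g v, csub_set W v -> csub_set W (pi g v),
    [/\ csub_set W `<=` S, irreducible (global_subrep W_inv)
      & induced_from_finite (global_subrep W_inv)].
Proof.
move=> S_inv [v0 Sv0 v0_neq0].
pose Q A := exists2 u, csub_set S u /\ invariants pi (stab A) u & u != 0.
have [A [v [Sv vA] v_neq0] Qmin] :
    exists2 A, Q A & forall B, Q B -> (#|` A| <= #|` B|)%N.
  apply: exists_minimal.
  by apply: (exists_stab_invariant (csubP S) S_inv Sv0 v0_neq0).
have A_min B : (#|` B| < #|` A|)%N ->
    forall u, csub_set S u -> invariants pi (stab B) u -> u = 0.
  move=> BA u Su uB; apply/eqP; apply: contraTT BA => u0.
  by rewrite -leqNgt; apply: Qmin; exists u.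
have ortho := minimal_support_ortho pi_diss S_inv A_min.
pose SA : set V := S `&` invariants pi (stab A).
have SA_inv : stable pi (set_stab A) SA.
  move=> h u [Su uA]; split; first exact: S_inv.
  have hA : gact (val h) @` [set` A] = [set` A] by exact: (set_mem (valP h)).
  by have := invariants_conj (g := val h) uA; rewrite hA.
have [f f_inj] := finite_set_stab_action G A.
(* One vector of the orbit of [v] for each induced permutation of [A]; the
   default [0] stands for permutations that are not induced. *)
pose l := [seq
    xget 0 [set w | exists2 h : set_stab A, f h = x & w = pi (val h) v]
  | x <- enum {ffun A -> A}].
have vl (h : set_stab A) : pi (val h) v \in l.
  apply/mapP; exists (f h); first by rewrite mem_enum.
  case: xgetP => [_ -> [k fk ->]|]; last first.
    by move=> /(_ (pi (val h) v)) []; exists h.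
  have := vA _ (f_inj _ _ fk) => e.
  by rewrite -[in RHS]e -repM mulVKg.
have cSA : closed_subspace SA.
  by apply: closed_subspaceI; [exact: csubP|exact: closed_subspace_invariants].
have [K [K_SA K_st K0 K_irr]] :=
  exists_irreducible cSA SA_inv (conj Sv vA) v_neq0 vl.
(* The closed span of the translates of [K] is their double orthogonal
   complement. *)
pose U : set V := [set w | exists g, exists2 u, csub_set K u & w = pi g u].
pose W : csub V := CSub (closed_subspace_orthocomp (orthocomp U)).
have U_inv g u : U u -> U (pi g u).
  by move=> [k [w Kw ->]]; exists (g * k)%g, w; rewrite ?repM.
have W_inv g u : csub_set W u -> csub_set W (pi g u).
  move=> /= uU x xU; rewrite rep_dotl; apply: uU => y Uy.
  by rewrite rep_dotl invgK; apply: xU; exact: U_inv.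
have UW u : U u -> csub_set W u by move=> Uu x xU; exact/hdot0_sym/xU.
have KU u : csub_set K u -> U u by move=> Ku; exists 1%g, u; rewrite ?rep1.
have W_total u : csub_set W u -> orthocomp U u -> u = 0.
  move=> Wu uU; apply: hdotvv_eq0; exact: Wu.
have WS : csub_set W `<=` S.
  by apply: biorthocomp_sub => _ [g [u Ku ->]]; apply: S_inv; case: (K_SA _ Ku).
(* What a fixed vector of [W] has outside [K] is orthogonal to [K] and, by
   minimality of [A], to its other translates. *)
have K_fix u : csub_set W u -> invariants pi (stab A) u -> csub_set K u.
  move=> Wu uA; pose d := u - val (hproj K u).
  have Kp := hsubP (hproj K u); have [_ pA] := K_SA _ Kp.
  suff d0 : d = 0.
    by have /eqP := d0; rewrite subr_eq0 => /eqP ->.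
  have Wd : csub_set W d.
    by apply: (closed_subspaceB (csubP W)) => //; exact/UW/KU.
  have dA : invariants pi (stab A) d.
    exact: (closed_subspaceB (closed_subspace_invariants pi (stab A))).
  apply: W_total => // _ [g [w Kw ->]].
  have [Sw wA] := K_SA _ Kw.
  have [gA|gA] := pselect (subgroup_set (set_stab A) g).
    by apply: (@hproj_ortho _ _ K); exact: (K_st (exist _ g (mem_set gA))).
  by apply: ortho => //; exact: WS.
pose K' : csub (hsub W) := CSub (closed_subspace_val_preimage W (csubP K)).
have K'_inv (h : set_stab A) u : csub_set K' u ->
    csub_set K' (global_subrep W_inv (val h) u).
  by rewrite /= => Ku; exact: K_st.
have KW u : csub_set K u -> csub_set W u by move=> /KU/UW.
suff [? ?] : irreducible (global_subrep W_inv) /\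
  induced_from_finite (global_subrep W_inv) by exists W, W_inv; split.
apply: (irreducible_induced K'_inv).
- have [u Ku /eqP u0] := K0; exists (to_hsub (KW _ Ku)) => //.
  by apply/eqP => /(congr1 val).
- move=> T cT TK T_inv.
  have [||T0|KT] := K_irr _ (closed_subspace_val_image cT).
  + by move=> _ [u /TK Ku <-].
  + move=> h _ [u Tu <-].
    by exists (global_subrep W_inv (val h) u); [exact: T_inv|].
  + by left=> u Tu; apply: val_inj; apply: T0; exists u.
  + by right=> u /= /KT[w Tw /val_inj <-].
- apply/seteqP; split=> [u uA|u /= Ku g gA].
    apply: K_fix; first exact: hsubP.
    by move=> g gA; rewrite -[RHS](congr1 val (uA g gA)).
  by apply: val_inj; rewrite val_global_subrep; apply: (K_SA _ Ku).2.
- move=> u uK; apply: val_inj; apply: W_total; first exact: hsubP.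
  move=> _ [g [w Kw ->]].
  have := uK g (global_subrep W_inv g (to_hsub (KW _ Kw))); apply.
  by rewrite /= repK.
- move=> g gA u w Ku Kw; rewrite hsub_hdotE val_global_subrep.
  have [Su uA] := K_SA _ Ku; have [Sw wA] := K_SA _ Kw.
  exact: ortho.
Qed.

End existence.

(** * Decomposition *)

(** Subspaces serve as the indices of the direct sum, which are to form a choice
    type. *)
HB.instance Definition _ (R : realType) (V : hilbertType R) :=
  gen_eqMixin (csub V).
HB.instance Definition _ (R : realType) (V : hilbertType R) :=
  gen_choiceMixin (csub V).

Theorem theorem1p4 (R : realType) (Omega : choiceType)
  (Omega_infinite : ([set: Omega] #= [set: nat])%card)
  (G : subgroup (sym Omega)) (G_closed : closed (G : set (sym Omega)))
  (G_noalg : no_algebraicity G)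
  (V : hilbertType R) (pi : unitary_rep G V) (pi_diss : dissociated pi) :
  exists (I : choiceType) (W : I -> hilbertType R)
         (pi_ : forall i, unitary_rep G (W i)),
  [/\ iso_direct_sum pi pi_,
      forall i, irreducible (pi_ i)
    & forall i, exists (A : set Omega) (K : hilbertType R)
                       (sigma : unitary_rep (setwise_stab G A) K),
        [/\ finite_set A,
            irreducible sigma,
            factors_through sigma
              [set h | (pointwise_stab G A : set G) (val h)]
          & iso_induced sigma (pi_ i)]].
Proof.
pose good (W : csub V) :=
  exists W_inv : forall g v, csub_set W v -> csub_set W (pi g v),
    irreducible (global_subrep W_inv) /\
    induced_from_finite (global_subrep W_inv).
pose P (F : set (csub V)) := F `<=` good /\
  forall W W', F W -> F W' -> W <> W' -> Defs.orthogonal W W'.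
have [F [[F_good F_ortho] F_max]] :
    exists F, P F /\ forall F', F `<` F' -> ~ P F'.
  apply: Zorn_bigcup => C CP C_total.
  split=> [W [F /CP[FG _] FW]|]; first exact: FG.
  move=> W W' [F CF FW] [F' CF' F'W'].
  have [FF'|F'F] := C_total _ _ CF CF'.
    by apply: (CP _ CF').2 => //; exact: FF'.
  by apply: (CP _ CF).2 => //; exact: F'F.
(* A nonzero vector orthogonal to the whole family would provide, inside the
   orthogonal complement, a member to add to it. *)
have F_total v : (forall W, F W -> orthocomp W v) -> v = 0.
  move=> vF; apply: contrapT => /eqP v0.
  pose S : csub V := CSub (closed_subspace_orthocomp (\bigcup_(W in F) W)).
  have S_inv g u : csub_set S u -> csub_set S (pi g u).
    move=> uF w [W FW Ww]; rewrite rep_dotl; apply: uF; exists W => //.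
    by have [W_inv _] := F_good _ FW; exact: W_inv.
  have [|W [W_inv [WS W_irr W_ind]]] := exists_induced_subrep pi_diss S_inv.
    by exists v => // w [W FW]; exact: vF.
  have WF W' : F W' -> Defs.orthogonal W W'.
    by move=> FW' u w Wu W'w; apply: (WS _ Wu); exists W'.
  have FW : ~ F W.
    move=> FW; have [[u /eqP u0] _] := W_irr; apply: u0; apply: val_inj.
    by apply: hdotvv_eq0; apply: (WF _ FW); exact: hsubP.
  apply: (F_max (F `|` [set W])); first split.
  - by move=> W' FW'; left.
  - by move=> /(_ W (or_intror erefl)).
  split=> [W' [/F_good//|->]|W1 W2 [FW1|->] [FW2|->] W12].
  - by exists W_inv.
  - exact: F_ortho.
  - by move=> u w W1u Ww; apply: hdot0_sym; exact: (WF _ FW1).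
  - exact: WF.
  - by [].
have inv (i : set_type F) := cid (F_good _ (set_valP i)).
pose pi_ (i : set_type F) := global_subrep (projT1 (inv i)).
have I_ortho (i j : set_type F) : [set: set_type F] i -> [set: set_type F] j ->
    i <> j -> Defs.orthogonal (val i) (val j).
  move=> _ _ ij; apply: F_ortho; [exact: set_valP|exact: set_valP|].
  by move=> /val_inj.
have I_total v :
    (forall i : set_type F, setT i -> orthocomp (val i) v) -> v = 0.
  move=> vI; apply: F_total => W FW.
  exact: (vI (exist _ W (mem_set FW))).
exists (set_type F), (fun i => hsub (val i)), pi_; split.
- exists (fun i => hproj (val i)); split.
  + apply/seteqP; split=> [_ [v _ <-]|w w_fin].
      by rewrite /l2_sum/= (parseval I_ortho v I_total) ltry.
    have [v vw _] := orthogonal_synthesis I_ortho w_fin.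
    by exists v => //; apply: functional_extensionality_dep => i; exact: vw.
  + by move=> v; exact: (parseval I_ortho v I_total).
  + move=> i g v; apply: val_inj; rewrite val_global_subrep; apply: hproj_rep.
      by move=> u; exact: (projT1 (inv i)).
    by move=> u; exact: (projT1 (inv i)).
- by move=> i; case: (projT2 (inv i)).
- by move=> i; case: (projT2 (inv i)).
Qed.
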